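(* In the radio network model with unknown topology (even without collision detection), there exists a randomized distributed algorithm that, within $O(D\log^4 n)$ rounds, constructs with high probability a Gathering Spanning Tree (GST) of $G$ rooted at the source $s$, in the distributed sense: at the end every node $u$ knows (1) its level $\ell(u)$, (2) its rank $r(u)$, (3) the id of its parent $v$ in the tree, and (4) the rank $r(v)$ of its parent.
   Context: Radio network model: a connected undirected graph $G=(V,E)$ with $n$ nodes (with unique ids) and a designated source $s$, operating in synchronous rounds; in each round each node transmits a packet of $B=\Omega(\log n)$ bits or listens; a listening node receives a packet only if exactly one neighbor transmits, and otherwise receives nothing. Nodes do not know $G$ but know a polynomial upper bound on $n$ and a constant-factor upper bound on the diameter $D$. Ranked BFS tree: a BFS tree $\mathcal{T}$ of $G$ rooted at $s$, where each node $v$ has level $\ell(v)=\mathrm{dist}_G(s,v)$ and each non-root node has as parent a $G$-neighbor at level $\ell(v)-1$. Ranks are assigned inductively: each leaf gets rank $1$; for an internal node $v$ let $r$ be the maximum rank of its children; $v$ gets rank $r$ if exactly one child has rank $r$, and rank $r+1$ if two or more children have rank $r$. Such a ranked BFS tree is a GST if it satisfies collision-freeness: whenever $u_1\neq u_2$ are nodes of rank $r$ on level $l$ whose parents $v_1\neq v_2$ (on level $l-1$) also both have rank $r$, then $G$ has no edge between $v_1$ and $u_2$ and no edge between $v_2$ and $u_1$. ''With high probability'' means with probability at least $1-1/n^{c}$ for a constant $c\ge1$.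
   Formalization: The unique ids are assumed to be bounded by a polynomial in n (O(log n) bits), which the statement leaves implicit; with arbitrarily long ids a node could not learn its parent's id within the claimed number of rounds. *)

(* Defs.v *)
From mathcomp Require Import all_boot all_order all_algebra.

Set Implicit Arguments.
Unset Strict Implicit.
Unset Printing Implicit Defensive.

Section Graphs.

Variables (V : finType) (e : rel V).

Definition simple_graph : Prop := symmetric e /\ irreflexive e.

Definition connected_graph : Prop := forall x y : V, connect e x y.

(* Length of a shortest e-path from x to y. Shortest paths repeat no vertex,
   so lengths below #|V| suffice; the value is #|V| when y is unreachable. *)
Definition dist (x y : V) : nat :=
  find (fun k => [exists p : k.-tuple V, path e x p && (last x p == y)])
       (iota 0 #|V|).

Definition diameter : nat := \max_(x : V) \max_(y : V) dist x y.

End Graphs.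

Section GatheringSpanningTree.

Variables (V : finType) (e : rel V) (s : V).

Implicit Types (par : V -> option V) (rk : V -> nat).

Definition is_BFS_tree par : bool :=
  [forall v : V,
     if par v is Some p
     then [&& v != s, e p v & dist e s v == (dist e s p).+1]
     else v == s].

Definition children par (v : V) : {set V} := [set u | par u == Some v].

Definition max_child_rank par rk (v : V) : nat :=
  \max_(u in children par v) rk u.

(* The bottom-up rank assignment, as the recursion equation it satisfies at
   every node; on a tree this equation has exactly one solution rk. *)
Definition is_ranking par rk : bool :=
  [forall v : V,
     rk v == (let r := max_child_rank par rk v in
              if children par v == set0 then 1
              else if #|[set u in children par v | rk u == r]| == 1 then r
              else r.+1)].

Definition collision_free par rk : bool :=
  [forall u1 : V, forall u2 : V, forall v1 : V, forall v2 : V,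
     [&& u1 != u2, v1 != v2, par u1 == Some v1, par u2 == Some v2,
         dist e s u1 == dist e s u2,
         rk u1 == rk u2, rk v1 == rk u1 & rk v2 == rk u2]
     ==> (~~ e v1 u2 && ~~ e v2 u1)].

Definition is_GST par rk : bool :=
  [&& is_BFS_tree par, is_ranking par rk & collision_free par rk].

End GatheringSpanningTree.

Definition packet (B : nat) : Type := B.-tuple bool.

(* out_parent is the pair (id of the parent, rank of the parent); the root,
   which has no parent, must output None. *)
Record node_output := NodeOutput {
  out_level  : nat;
  out_rank   : nat;
  out_parent : option (nat * nat)
}.

(* The code run by every node. A node starts knowing only its own id, whether
   it is the source, and a private seed, uniform on a finite set of the
   protocol's choosing; the seed holds all the random bits of the execution.
   [transmit] returns None when the node listens. *)
Record protocol (B : nat) := Protocol {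
  seed     : finType;
  state    : Type;
  rounds   : nat;
  init     : nat -> bool -> seed -> state;
  transmit : state -> option (packet B);
  update   : state -> option (packet B) -> state;
  output   : state -> node_output
}.

(* What the nodes know in common: a bound N on the number of nodes, a bound
   Dhat on the diameter, and the packet size B. *)
Definition algorithm : Type := forall N Dhat B : nat, protocol B.

Section Execution.

Variables (V : finType) (e : rel V) (s : V) (id : V -> nat).
Variables (B : nat) (P : protocol B).

Definition config : Type := V -> state P.

Definition transmitting_neighbors (sigma : config) (v : V) : seq V :=
  [seq u <- enum V | e v u && isSome (transmit (sigma u))].

(* No collision detection: a listening node gets the same None from silence
   and from a collision. A transmitting node receives nothing. *)
Definition received (sigma : config) (v : V) : option (packet B) :=
  if isSome (transmit (sigma v)) then None
  else if transmitting_neighbors sigma v is [:: u] then transmit (sigma u)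
  else None.

Definition round (sigma : config) : config :=
  fun v => update (sigma v) (received sigma v).

Definition seeds : finType := {ffun V -> seed P}.

Definition start (w : seeds) : config := fun v => init (id v) (v == s) (w v).

Definition final_output (w : seeds) (v : V) : node_output :=
  output (iter (rounds P) round (start w) v).

(* The ranks of the tree are read off the outputs; is_GST forces them to be
   the ranks of the tree par. *)
Definition constructs_GST (w : seeds) : bool :=
  let out := final_output w in
  let rk := fun v => out_rank (out v) in
  [exists par : {ffun V -> option V},
     is_GST e s par rk &&
     [forall u : V,
        (out_level (out u) == dist e s u) &&
        (out_parent (out u) == omap (fun v => (id v, rk v)) (par u))]].

Definition success_probability : rat :=
  (#|[set w : seeds | constructs_GST w]|%:R / #|seeds|%:R)%R.

End Execution.

(* Main.v *)
Require Import Defs.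
From mathcomp Require Import all_boot all_order all_algebra.
From mathcomp Require Import boolp.
From mathcomp Require Import zify ring lra.

(**
Levels are computed by Decay broadcasts, after which every node knows one
neighbor on the previous level. The tree is then built from the deepest level
upwards and, on each level, from the highest rank down. For rank r, the blue
nodes are the nodes of rank r on level t without a parent, the red nodes those
of level t - 1; a red node is live if it has a rank already (then larger than
r) or at least two blue neighbors. When all blue nodes transmit at once, a red
node receives a packet exactly when it has one blue neighbor, so red nodes that
are not live can keep silent. Live red nodes wake up with probability p; a blue
node with a single awake neighbor v becomes a candidate of v. If the candidates
of v are at least two (they do not get through when all of them transmit, but
one gets through in a Decay), then v takes rank r + 1 and adopts them; a red
node that had a rank adopts its candidates in any case. If all blue nodes have
fewer than d live neighbors and p = 1 / (4 d), a blue node with at least d / 2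
of them is adopted with probability at least 1 / 128. So O(log n) attempts halve
the maximal number of live neighbors, and after O(log n) scales no blue node has
a live neighbor. The neighbors of each remaining blue node then have no other
blue neighbor, so it can take any of them as its parent, which gets rank r; this
creates no collision. An attempt takes O(log n) rounds, hence a rank takes
O(log^3 n) and a level O(log^4 n) rounds.
*)

Set Implicit Arguments.
Unset Strict Implicit.
Unset Printing Implicit Defensive.

Import Order.TTheory GRing.Theory Num.Theory.

(** * Independent uniform coins and the probability of isolation *)

Section Expectation.

Variables (V : finType) (m : nat).

Local Open Scope ring_scope.

(** One draw per node serves every scale: for [j <= m] the event [c v < 2 ^ (m - j)] has probability
    exactly [2 ^- j]. *)
Definition coins := {ffun V -> 'I_(2 ^ m)}.

Definition expectation (f : coins -> rat) : rat :=
  (\sum_c f c) / #|{: coins}|%:R.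

Lemma card_coins_gt0 : 0 < #|{: coins}|%:R :> rat.
Proof. by rewrite ltr0n card_ffun card_ord !expn_gt0. Qed.

Lemma le_expectation f g : (forall c, f c <= g c) -> expectation f <= expectation g.
Proof.
move=> lefg; rewrite ler_pM2r ?invr_gt0 ?card_coins_gt0 //.
exact: ler_sum.
Qed.

Lemma expectation_const k : expectation (fun=> k) = k.
Proof.
rewrite /expectation sumr_const -[k *+ _]mulr_natr mulfK //.
by rewrite gt_eqF // card_coins_gt0.
Qed.

Lemma expectationD f g :
  expectation (fun c => f c + g c) = expectation f + expectation g.
Proof. by rewrite /expectation big_split mulrDl. Qed.

Lemma expectationZ k f : expectation (fun c => k * f c) = k * expectation f.
Proof. by rewrite /expectation -mulr_sumr mulrA. Qed.

Lemma expectation_sum (I : finType) (P : pred I) (F : I -> coins -> rat) :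
  expectation (fun c => \sum_(i | P i) F i c) = \sum_(i | P i) expectation (F i).
Proof. by rewrite /expectation exchange_big /= mulr_suml. Qed.

Definition isolated (j : nat) (v : V) (W : {set V}) (c : coins) : bool :=
  (c v < 2 ^ (m - j))%N && [forall w in W, ~~ (c w < 2 ^ (m - j))%N].

Lemma card_coin_lt (j : nat) :
  #|[pred x : 'I_(2 ^ m) | (x < 2 ^ (m - j))%N]| = (2 ^ (m - j))%N.
Proof.
have le : (2 ^ (m - j) <= 2 ^ m)%N by rewrite leq_exp2l // leq_subr.
have inj : injective (widen_ord le) by move=> x y [] /val_inj.
rewrite -[RHS]card_ord -(card_imset _ inj).
apply: eq_card => x; rewrite !inE; apply/idP/imsetP => [lt|[y _ ->]].
  by exists (Ordinal lt) => //; apply: val_inj.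
by rewrite /= ltn_ord.
Qed.

(** The event constrains each node separately, so it is the product set [family F] and its
    cardinality factors over the nodes. *)
Lemma pr_isolated (j : nat) (v : V) (W : {set V}) :
  (j <= m)%N -> v \notin W ->
  expectation (fun c => (isolated j v W c)%:R) =
  2%:R ^- j * (1 - 2%:R ^- j) ^+ #|W|.
Proof.
move=> lejm vW; set p := 2%:R ^- j.
have q0 : (2 ^ m)%:R != 0 :> rat by rewrite pnatr_eq0 -lt0n expn_gt0.
have pE : (2 ^ (m - j))%:R / (2 ^ m)%:R = p :> rat.
  rewrite -{2}(subnK lejm) expnD natrM invfM mulrA mulfV ?mul1r ?natrX //.
  by rewrite expf_neq0.
pose F (x : V) : pred 'I_(2 ^ m) :=
  if x == v then [pred y : 'I_(2 ^ m) | (y < 2 ^ (m - j))%N]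
  else if x \in W then [predC [pred y : 'I_(2 ^ m) | (y < 2 ^ (m - j))%N]]
  else predT.
have -> : expectation (fun c => (isolated j v W c)%:R) =
          #|family F|%:R / #|{: coins}|%:R.
  congr (_ / _); rewrite -sum1_card natr_sum [RHS]big_mkcond /=.
  apply: eq_bigr => c _; rewrite -[RHS]/(if c \in family F then 1 else 0).
  suff -> : isolated j v W c = (c \in family F) by case: (c \in _).
  apply/idP/familyP => [/andP[cv /forall_inP cW] x | H].
    rewrite /F; case: eqP => [->//|_]; case: ifP => // xW; rewrite !inE.
    exact: cW.
  apply/andP; split; first by have := H v; rewrite /F eqxx.
  apply/forall_inP => w wW; have := H w; rewrite /F wW.
  by case: eqP => // ewv; rewrite -ewv wW in vW.
rewrite card_family card_ffun card_ord foldrE big_map big_enum /=.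
rewrite natr_prod.
have -> : (((2 ^ m) ^ #|V|)%:R : rat) = \prod_(x : V) (2 ^ m)%:R.
  by rewrite prodr_const natrX.
rewrite -prodf_div (bigD1 v) //= {1}/F eqxx card_coin_lt pE; congr (_ * _).
rewrite (bigID (mem W)) /= [X in _ * X]big1 ?mulr1; last first.
  move=> x /andP[/negbTE xv /negbTE xW]; rewrite /F xv xW card_ord.
  exact: divff.
rewrite (eq_bigr (fun=> 1 - p)) => [|x /andP[/negbTE xv xW]]; last first.
  rewrite /F xv xW; have := cardC [pred y : 'I_(2 ^ m) | (y < 2 ^ (m - j))%N].
  rewrite card_coin_lt card_ord => /(congr1 (fun k => k%:R : rat)).
  rewrite natrD -pE => /(canRL (addKr _)) ->.
  by rewrite mulrDl divff // addrC mulNr.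
rewrite prodr_const; congr (_ ^+ _); apply: eq_card => x.
by rewrite unfold_in /= andb_idl // => xW; apply: contraNneq vW => <-.
Qed.

Lemma bernoulli (p : rat) k : 0 <= p <= 1 -> 1 - k%:R * p <= (1 - p) ^+ k.
Proof.
move=> /andP[p0 p1]; elim: k => [|k IH]; first by rewrite mul0r subr0 expr0.
rewrite exprS; apply: le_trans (_ : (1 - p) * (1 - k%:R * p) <= _); last first.
  by rewrite ler_wpM2l // subr_ge0.
rewrite -natr1; have : 0 <= k%:R * p * p by rewrite !mulr_ge0.
move: (k%:R) => x; nra.
Qed.

(* The events "v is isolated from W v", v in S, exclude each other because
   each W v contains the rest of S. *)
Lemma isolation (j k : nat) (S : {set V}) (W : V -> {set V})
    (q : rat) (f : coins -> rat) :
  (j <= m)%N -> 0 <= q -> (forall c, 0 <= f c) ->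
  (forall v, v \in S -> v \notin W v) ->
  (forall v, v \in S -> S :\ v \subset W v) ->
  (forall v, v \in S -> (#|W v| <= k)%N) ->
  (forall c v, v \in S -> isolated j v (W v) c -> q <= f c) ->
  q * (#|S|%:R * 2%:R ^- j * (1 - k%:R * 2%:R ^- j)) <= expectation f.
Proof.
move=> lejm q0 f0 vW SW Wk qf.
have p0 : 0 <= 2%:R ^- j :> rat by rewrite invr_ge0 exprn_ge0.
have p1 : 2%:R ^- j <= 1 :> rat by rewrite invf_le1 ?exprn_gt0 // exprn_ege1.
apply: (@le_trans _ _
  (expectation (fun c => \sum_(v in S) (q * (isolated j v (W v) c)%:R)))).
  rewrite expectation_sum (eq_bigr (fun v =>
    q * (2%:R ^- j * (1 - 2%:R ^- j) ^+ #|W v|))); last first.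
    by move=> v vS; rewrite expectationZ pr_isolated // vW.
  rewrite -[leLHS]/(q * _) -mulr_sumr ler_wpM2l //.
  rewrite -mulrA mulr_natl -sumr_const; apply: ler_sum => v vS.
  rewrite ler_wpM2l //; apply: le_trans (bernoulli _ _); last by rewrite p0 p1.
  by rewrite lerD2l lerN2 ler_wpM2r // ler_nat Wk.
apply: le_expectation => c.
have [/existsP[v /andP[vS vi]]|none] :=
  boolP [exists v, (v \in S) && isolated j v (W v) c].
  rewrite (bigD1 v) //= vi mulr1 big1 ?addr0 ?(qf _ _ vS) // => w /andP[wS wv].
  case wi: (isolated _ _ _ _); last by rewrite mulr0.
  case/andP: vi => cv _; case/andP: wi => _ /forall_inP/(_ v).
  rewrite (subsetP (SW w wS)) ?cv; first by move/(_ isT).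
  by rewrite !inE eq_sym wv.
rewrite big1 // => v vS; case vi: (isolated _ _ _ _); last by rewrite mulr0.
by case/existsP: none; exists v; rewrite vS.
Qed.

End Expectation.

(* One instruction of a program: a node in state x that draws the coin k sends
   the message [tx x k], of which the [width] low-order bits are delivered. *)
Record instr (S : Type) := Instr {
  width : nat;
  tx    : S -> nat -> option nat;
  up    : S -> nat -> option nat -> S
}.

(** * Probabilistic semantics of programs and rules for failure bounds *)

Section Programs.

Variables (V : finType) (e : rel V) (m : nat) (S : Type).

Implicit Types (i : instr S) (P : seq (instr S)) (sigma tau : V -> S).

(** The reception rule of the model, with numbers cut to [X] bits in place of packets. *)
Definition hears (X : nat) (f : V -> option nat) (v : V) : option nat :=
  if isSome (f v) then None
  else if [seq u <- enum V | e v u && isSome (f u)] is [:: u]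
       then omap (modn^~ (2 ^ X)) (f u) else None.

Lemma filter_enum1 (p : pred V) (u : V) :
  p u -> (forall w, p w -> w = u) -> [seq w <- enum V | p w] = [:: u].
Proof.
move=> pu uq.
apply: perm_small_eq => //.
apply: uniq_perm => [||w //]; first exact: filter_uniq (enum_uniq _).
  by [].
rewrite mem_filter mem_enum andbT inE.
by apply/idP/eqP => [/uq|->].
Qed.

Lemma filter_enum1_inv (p : pred V) (u : V) :
  [seq w <- enum V | p w] = [:: u] -> p u /\ forall w, p w -> w = u.
Proof.
move=> E; have mem w : p w = (w == u).
  by have := mem_filter p w (enum V); rewrite E inE mem_enum andbT.
by split=> [|w]; rewrite mem => // /eqP.
Qed.

Lemma hearsP X f v y :
  hears X f v = Some y <->
  f v = None /\ exists u x,
    [/\ e v u, f u = Some x, y = x %% 2 ^ X & forall w, e v w -> f w -> w = u].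
Proof.
rewrite /hears; split.
  case: (f v) => //=; case E: [seq _ <- _ | _] => [|u [|//]] //.
  case/filter_enum1_inv: E => /andP[evu]; case Eu: (f u) => [x|] //= _ uq [<-].
  split=> //; exists u, x; split=> // w evw fw; apply: uq.
  by rewrite evw.
case=> -> [u [x [evu Eu -> uq]]] /=.
rewrite (@filter_enum1 _ u) ?Eu ?evu // => w /andP[]; exact: uq.
Qed.

Lemma hears_None X f v : (forall w, e v w -> f w = None) -> hears X f v = None.
Proof.
move=> none; case E: (hears X f v) => [y|] //.
by case/hearsP: E => _ [u [x [/none ->]]].
Qed.

Definition step i (c : V -> nat) sigma : V -> S :=
  fun v => up i (sigma v) (c v)
             (hears (width i) (fun u => tx i (sigma u) (c u)) v).

Definition cstep i (c : coins V m) := step i (fun v => c v).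

Local Open Scope ring_scope.

(** Expected value of [f] at the end of [P], computed backwards like a weakest precondition; every
    instruction draws fresh coins. *)
Fixpoint wp P (f : (V -> S) -> rat) sigma : rat :=
  if P is i :: P' then expectation (fun c => wp P' f (cstep i c sigma))
  else f sigma.

Fixpoint surely P (Q : (V -> S) -> Prop) sigma : Prop :=
  if P is i :: P' then forall c, surely P' Q (cstep i c sigma) else Q sigma.

Definition pr P (Q : (V -> S) -> Prop) : (V -> S) -> rat :=
  wp P (fun tau => `[< Q tau >]%:R).

(** [eps] bounds the probability of missing [B], uniformly over the configurations in [A]. This
    uniformity lets failure bounds add up along a program. *)
Definition hoare (A : (V -> S) -> Prop) P (B : (V -> S) -> Prop) (eps : rat) :=
  forall sigma, A sigma -> pr P (fun tau => ~ B tau) sigma <= eps.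

Lemma wp_cat P1 P2 f sigma : wp (P1 ++ P2) f sigma = wp P1 (wp P2 f) sigma.
Proof.
elim: P1 sigma => //= i P1 IH sigma.
by apply: congr1; apply: funext => c; exact: IH.
Qed.

Lemma surely_cat P1 P2 Q sigma :
  surely (P1 ++ P2) Q sigma <-> surely P1 (surely P2 Q) sigma.
Proof.
elim: P1 sigma => //= i P1 IH sigma.
by split=> H c; apply/IH.
Qed.

Lemma surely_mono P (A B : (V -> S) -> Prop) sigma :
  (forall tau, A tau -> B tau) -> surely P A sigma -> surely P B sigma.
Proof.
move=> AB; elim: P sigma => [|i P IH] sigma /=; first exact: AB.
by move=> H c; apply: IH.
Qed.

Lemma surely_and P (A B : (V -> S) -> Prop) sigma :
  surely P A sigma -> surely P B sigma ->
  surely P (fun tau => A tau /\ B tau) sigma.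
Proof.
elim: P sigma => [|i P IH] sigma //= HA HB c; exact: IH.
Qed.

Lemma surely_seq P1 P2 (A B : (V -> S) -> Prop) sigma :
  surely P1 A sigma -> (forall tau, A tau -> surely P2 B tau) ->
  surely (P1 ++ P2) B sigma.
Proof. by move=> H1 H2; apply/surely_cat; apply: surely_mono H1. Qed.

Lemma surely_map (I : Type) (F : I -> instr S) (s : seq I)
    (A : (V -> S) -> Prop) sigma :
  (forall x c tau, A tau -> A (cstep (F x) c tau)) ->
  A sigma -> surely [seq F x | x <- s] A sigma.
Proof.
by move=> H; elim: s sigma => [|x s IH] sigma //= As c; apply: IH; apply: H.
Qed.

Lemma wp_le_surely P (A : (V -> S) -> Prop) f g sigma :
  surely P A sigma -> (forall tau, A tau -> f tau <= g tau) ->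
  wp P f sigma <= wp P g sigma.
Proof.
move=> sA fg; elim: P sigma sA => [|i P IH] sigma /= sA; first exact: fg.
by apply: le_expectation => c; apply: IH.
Qed.

Lemma wp_le P f g sigma :
  (forall tau, f tau <= g tau) -> wp P f sigma <= wp P g sigma.
Proof.
move=> fg; apply: (@wp_le_surely P (fun=> True)) => //.
by elim: P sigma => //= i P IH sigma c.
Qed.

Lemma wp_const P k sigma : wp P (fun=> k) sigma = k.
Proof.
elim: P sigma => //= i P IH sigma; rewrite -[RHS](@expectation_const V m).
by congr expectation; apply: funext.
Qed.

Lemma wpD P f g sigma :
  wp P (fun tau => f tau + g tau) sigma = wp P f sigma + wp P g sigma.
Proof.
elim: P sigma => //= i P IH sigma; rewrite -expectationD.
by congr expectation; apply: funext.
Qed.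

Lemma wpZ P k f sigma : wp P (fun tau => k * f tau) sigma = k * wp P f sigma.
Proof.
elim: P sigma => //= i P IH sigma; rewrite -expectationZ.
by congr expectation; apply: funext.
Qed.

Lemma pr_ge0 P Q sigma : 0 <= pr P Q sigma.
Proof. by rewrite -[leLHS](wp_const P 0 sigma); apply: wp_le => tau. Qed.

Lemma pr_not P Q sigma : pr P (fun tau => ~ Q tau) sigma = 1 - pr P Q sigma.
Proof.
apply/eqP; rewrite eq_sym subr_eq -wpD -[eqbLHS](wp_const P 1 sigma); apply/eqP.
by apply: congr2 => //; apply: funext => tau; rewrite asbool_neg; case: asbool.
Qed.

Lemma pr_surely P Q sigma : surely P Q sigma -> pr P Q sigma = 1.
Proof.
move=> sQ; apply: le_anti; apply/andP; split.
  by rewrite -[leRHS](wp_const P 1 sigma); apply: wp_le => tau; case: asbool.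
by rewrite -[leLHS](wp_const P 1 sigma); apply: wp_le_surely sQ _ => tau Qt; rewrite asboolT.
Qed.

Lemma pr_surely_not P Q sigma :
  surely P Q sigma -> pr P (fun tau => ~ Q tau) sigma = 0.
Proof. by move=> sQ; rewrite pr_not pr_surely // subrr. Qed.

Lemma pr_le_surely P (A Q R : (V -> S) -> Prop) sigma :
  surely P A sigma -> (forall tau, A tau -> Q tau -> R tau) ->
  pr P Q sigma <= pr P R sigma.
Proof.
move=> sA QR; apply: wp_le_surely sA _ => tau At; rewrite ler_nat.
by case: (asboolP (Q tau)) => // Qt; rewrite asboolT //; exact: QR.
Qed.

Lemma hoare_surely A P B :
  (forall sigma, A sigma -> surely P B sigma) -> hoare A P B 0.
Proof. by move=> H sigma /H/pr_surely_not ->. Qed.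

Lemma hoare_weaken (A A' B B' : (V -> S) -> Prop) P eps :
  (forall sigma, A' sigma -> A sigma) -> (forall tau, B tau -> B' tau) ->
  hoare A P B eps -> hoare A' P B' eps.
Proof.
move=> AA BB H sigma /AA/H; apply: le_trans; apply: wp_le => tau.
rewrite ler_nat; case: (asboolP (B tau)) => [/BB Bt|nB].
  by rewrite asboolF //; exact.
by rewrite [`[< ~ B _ >]]asboolT // leq_b1.
Qed.

(** Union bound: where [P1] misses [B], the failure of [P2] is bounded by 1, and elsewhere by
    [eps2]. *)
Lemma hoare_cat A B C P1 P2 eps1 eps2 :
  0 <= eps2 -> hoare A P1 B eps1 -> hoare B P2 C eps2 ->
  hoare A (P1 ++ P2) C (eps1 + eps2).
Proof.
move=> e0 H1 H2 sigma As; rewrite /pr wp_cat.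
apply: le_trans (_ : wp P1 (fun tau => `[< ~ B tau >]%:R + eps2) sigma <= _).
  apply: wp_le => tau; case: (asboolP (B tau)) => [Bt|nB].
    by rewrite asboolF ?add0r //; exact: H2.
  rewrite asboolT // -[leLHS]addr0 lerD // -[leRHS](wp_const P2 1 tau).
  by apply: wp_le => u; case: asbool.
by rewrite wpD wp_const lerD2r; apply: H1.
Qed.

Lemma hoare_forall (I : finType) A (B : I -> (V -> S) -> Prop) P eps :
  (forall x, hoare A P (B x) eps) ->
  hoare A P (fun tau => forall x, B x tau) (#|I|%:R * eps).
Proof.
move=> H sigma As.
apply: le_trans (_ : wp P (fun tau => \sum_x `[< ~ B x tau >]%:R) sigma <= _).
  apply: wp_le => tau; case: asboolP => [nB|_]; last exact: sumr_ge0.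
  have [x nBx] : exists x, ~ B x tau by apply/existsNP.
  by rewrite (bigD1 x) //= asboolT // lerDl sumr_ge0.
have -> : wp P (fun tau => \sum_x `[< ~ B x tau >]%:R) sigma =
          \sum_x pr P (fun tau => ~ B x tau) sigma.
  elim: (index_enum I) => [|x s IH].
    rewrite big_nil -[RHS](wp_const P 0 sigma); congr wp.
    by apply: funext => tau; rewrite big_nil.
  rewrite big_cons -IH -wpD; congr wp.
  by apply: funext => tau; rewrite big_cons.
rewrite mulr_natl -sumr_const; apply: ler_sum => x _; exact: H.
Qed.

Lemma hoare_and_surely A P (B C : (V -> S) -> Prop) eps :
  (forall sigma, A sigma -> surely P C sigma) -> hoare A P B eps ->
  hoare A P (fun tau => B tau /\ C tau) eps.
Proof.
move=> sC H sigma As; apply: le_trans (H _ As); apply: (pr_le_surely (sC _ As)).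
by move=> tau Ct nBC Bt; apply: nBC.
Qed.

Fixpoint retry (T : nat) P := if T is T'.+1 then P ++ retry T' P else [::].

Fixpoint upto (n : nat) (F : nat -> seq (instr S)) :=
  if n is n'.+1 then upto n' F ++ F n' else [::].

(* Indices n, n - 1, ..., 1. *)
Fixpoint downfrom (n : nat) (F : nat -> seq (instr S)) :=
  if n is n'.+1 then F n ++ downfrom n' F else [::].

Lemma surely_retry T P (A : (V -> S) -> Prop) :
  (forall sigma, A sigma -> surely P A sigma) ->
  forall sigma, A sigma -> surely (retry T P) A sigma.
Proof.
move=> H; elim: T => //= T IH sigma As; exact: surely_seq (H _ As) _.
Qed.

(** Once reached, [B] persists, so missing it means that [T] consecutive runs fail, each with
    conditional probability at most [1 - q] because [A] holds again at its start. *)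
Lemma pr_retry T P (A B : (V -> S) -> Prop) q :
  q <= 1 ->
  (forall sigma, A sigma -> surely P A sigma) ->
  (forall sigma, A sigma -> B sigma -> surely P B sigma) ->
  (forall sigma, A sigma -> ~ B sigma -> q <= pr P B sigma) ->
  forall sigma, A sigma ->
  pr (retry T P) (fun tau => ~ B tau) sigma <= (1 - q) ^+ T.
Proof.
move=> q1 HA HB Hq; elim: T => [|T IH] sigma As /=.
  by rewrite expr0 /pr /=; case: asbool.
have ge0 k : 0 <= (1 - q) ^+ k by rewrite exprn_ge0 // subr_ge0.
have [Bs|nBs] := pselect (B sigma).
  rewrite (@pr_surely_not (retry T.+1 P)) //.
  apply: surely_mono (_ : surely (retry T.+1 P) (fun t => A t /\ B t) sigma).
    by move=> tau [].
  apply: surely_retry => // tau [At Bt]; apply: surely_and; first exact: HA.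
  exact: HB.
rewrite /pr wp_cat.
apply: le_trans (_ : wp P (fun t => (1 - q) ^+ T * `[< ~ B t >]%:R) sigma <= _).
  apply: (wp_le_surely (HA _ As)) => tau At; have [Bt|nBt] := pselect (B tau).
    have -> : `[< ~ B tau >] = false by apply: asboolF.
    rewrite mulr0.
    rewrite -[wp _ _ _]/(pr _ _ _) pr_surely_not //.
    apply: surely_mono (_ : surely (retry T P) (fun t => A t /\ B t) tau).
      by move=> ? [].
    apply: surely_retry => // u [Au Bu]; apply: surely_and; first exact: HA.
    exact: HB.
  have -> : `[< ~ B tau >] = true by apply: asboolT.
  by rewrite mulr1; apply: IH.
rewrite wpZ exprSr ler_wpM2l // -[wp _ _ _]/(pr _ _ _) pr_not lerD2l lerN2.
exact: Hq.
Qed.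

Lemma hoare_upto n F (A : nat -> (V -> S) -> Prop) eps :
  0 <= eps -> (forall k, (k < n)%N -> hoare (A k) (F k) (A k.+1) eps) ->
  hoare (A 0) (upto n F) (A n) (n%:R * eps).
Proof.
move=> e0; elim: n => [|n IH] H /=.
  by rewrite mul0r; apply: hoare_surely.
rewrite -natr1 mulrDl mul1r; apply: hoare_cat => //; last exact: H.
by apply: IH => k lt; apply: H; apply: ltnW.
Qed.

Lemma hoare_downfrom n F (A : nat -> (V -> S) -> Prop) eps :
  0 <= eps -> (forall k, (k < n)%N -> hoare (A k.+1) (F k.+1) (A k) eps) ->
  hoare (A n) (downfrom n F) (A 0) (n%:R * eps).
Proof.
move=> e0; elim: n => [|n IH] H /=.
  by rewrite mul0r; apply: hoare_surely.
rewrite -natr1 mulrDl mul1r addrC.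
apply: hoare_cat; [by rewrite mulr_ge0|exact: H|].
by apply: IH => k lt; apply: H; apply: ltnW.
Qed.

(** For Decay sweeps, where many transmission probabilities are tried and one of them, [x0], is
    right: what precedes [x0] keeps [A], and what follows it keeps [B]. *)
Lemma pr_map (I : eqType) (F : I -> instr S) (s : seq I) (x0 : I)
    (A B : (V -> S) -> Prop) q :
  (forall x c tau, A tau -> A (cstep (F x) c tau)) ->
  (forall x c tau, A tau -> B tau -> B (cstep (F x) c tau)) ->
  x0 \in s ->
  (forall tau, A tau -> q <= expectation (fun c => `[< B (cstep (F x0) c tau) >]%:R)) ->
  forall sigma, A sigma -> q <= pr [seq F x | x <- s] B sigma.
Proof.
move=> HA HB x0s Hq.
elim: s x0s => [|x s IH] //; rewrite inE => /orP[/eqP <- | x0s] sigma As; last first.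
  rewrite /pr /= -[leLHS](expectation_const V m); apply: le_expectation => c.
  by apply: IH => //; apply: HA.
apply: le_trans (Hq _ As) _; rewrite /pr /=; apply: le_expectation => c.
case: asboolP => [Bt|_]; last exact: pr_ge0.
rewrite -[wp _ _ _]/(pr _ _ _) pr_surely //.
apply: surely_mono (_ : surely _ (fun t => A t /\ B t) _); first by move=> ? [].
apply: surely_map => [y d tau [At Bt']|]; split=> //; auto.
Qed.

End Programs.

(** * Compilation to the radio model, one bit per round *)

Lemma modn_exp2S x k : x %% 2 ^ k.+1 = x %% 2 ^ k + odd (x %/ 2 ^ k) * 2 ^ k.
Proof.
set q := x %/ 2 ^ k; have r_lt : x %% 2 ^ k < 2 ^ k by rewrite ltn_mod expn_gt0.
rewrite {1}(divn_eq x (2 ^ k)) -/q -{1}(odd_double_half q) expnS.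
have -> : (odd q + q./2.*2) * 2 ^ k + x %% 2 ^ k =
          q./2 * (2 * 2 ^ k) + (x %% 2 ^ k + odd q * 2 ^ k).
  by rewrite -muln2; ring.
rewrite modnMDl modn_small //; case: (odd q); lia.
Qed.

Section Compilation.

Variables (m : nat) (S : Type) (P : seq (instr S)).
Variables (ini : nat -> bool -> S) (outp : S -> node_output) (B : nat).

(* An instruction of width X takes X + 1 rounds: in round 0 all its senders
   transmit, in round j.+1 those whose message has bit j set. Packets have no
   content; the message is read off the presence or absence of packets. *)
Record machine := Machine {
  prog   : seq (instr S);
  core   : S;
  draws  : seq nat;
  pos    : nat;
  header : bool;
  acc    : nat
}.

Definition sending (x : machine) : bool :=
  if prog x is i :: _ then
    if tx i (core x) (head 0 (draws x)) is Some y
    then (pos x == 0) || odd (y %/ 2 ^ (pos x).-1) else false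
  else false.

Definition machine_transmit (x : machine) : option (packet B) :=
  if sending x then Some [tuple of nseq B false] else None.

Definition machine_update (x : machine) (rx : option (packet B)) : machine :=
  if prog x is i :: P' then
    let h := if pos x == 0 then isSome rx else header x in
    let b := if pos x == 0 then 0 else acc x + isSome rx * 2 ^ (pos x).-1 in
    if pos x == width i
    then Machine P' (up i (core x) (head 0 (draws x)) (if h then Some b else None))
           (behead (draws x)) 0 false 0
    else Machine (prog x) (core x) (draws x) (pos x).+1 h b
  else x.

Definition duration (Q : seq (instr S)) := \sum_(i <- Q) (width i).+1.

Definition compile : protocol B :=
  @Protocol B ((size P).-tuple 'I_(2 ^ m)) machine (duration P)
    (fun x b w => Machine P (ini x b) [seq val c | c <- w] 0 false 0)
    machine_transmit machine_update (fun x => outp (core x)).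

Variables (V : finType) (e : rel V) (s : V) (id : V -> nat).

Local Notation mround := (@round V e B compile).

Lemma isSome_machine_transmit x : isSome (machine_transmit x) = sending x.
Proof. by rewrite /machine_transmit; case: sending. Qed.

Lemma isSome_received (sigma : V -> machine) v :
  isSome (@received V e B compile sigma v) =
  isSome (hears e 0 (fun u => if sending (sigma u) then Some 0 else None) v).
Proof.
rewrite /received /hears /transmitting_neighbors /= isSome_machine_transmit.
have -> : isSome (if sending (sigma v) then Some 0 else None) = sending (sigma v).
  by case: sending.
case: sending => //.
have -> : [seq u <- enum V | e v u & machine_transmit (sigma u)] =
  [seq u <- enum V | e v u & isSome (if sending (sigma u) then Some 0 else None)].
  apply: eq_filter => u /=; rewrite -/(isSome _) isSome_machine_transmit.
  by case: sending.
case: [seq _ <- _ | _] => [|u []] //.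
by rewrite -/(isSome _) isSome_machine_transmit; case: sending.
Qed.

Fixpoint run (Q : seq (instr S)) (d : V -> seq nat) (kappa : V -> S) : V -> S :=
  if Q is i :: Q' then
    run Q' (fun v => behead (d v)) (step e i (fun v => head 0 (d v)) kappa)
  else kappa.

Lemma isSome_hears X Y f g v :
  (forall u, isSome (f u) = isSome (g u)) ->
  isSome (hears e X f v) = isSome (hears e Y g v).
Proof.
move=> fg; rewrite /hears fg; case: (isSome (g v)) => //.
under eq_filter do rewrite fg.
by case: [seq _ <- _ | _] => [|u []] //; have := fg u; case: (f u); case: (g u).
Qed.

Section Instruction.

Variables (i : instr S) (Q : seq (instr S)) (d : V -> seq nat) (kappa : V -> S).

Let f u := tx i (kappa u) (head 0 (d u)).

(** State inside an instruction after [j] rounds, [j > 0]: the header has already recorded whether a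
    message is being heard. *)
Definition midway j (a : V -> nat) : V -> machine :=
  fun v => Machine (i :: Q) (kappa v) (d v) j (isSome (hears e 0 f v)) (a v).

(** [u] is the only neighbor taking part in the instruction, so nothing can collide with its bit
    [j], and silence reliably means 0. *)
Lemma received_midway j a v u x :
  f v = None -> e v u -> f u = Some x -> (forall w, e v w -> f w -> w = u) ->
  isSome (@received V e B compile (midway j.+1 a) v) = odd (x %/ 2 ^ j).
Proof.
move=> fv evu fu uq.
rewrite isSome_received.
set g := fun w => _.
have gE w : isSome (g w) = if f w is Some z then odd (z %/ 2 ^ j) else false.
  by rewrite /g /sending /= -/(f w); case: (f w) => // z; case: odd.
case bit: (odd _).
  have gu : g u = Some 0 by have := gE u; rewrite fu bit /g; case: sending.
  have -> // : hears e 0 g v = Some 0.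
  apply/hearsP; split; first by have := gE v; rewrite fv; case: (g v).
  exists u, 0; split=> // w evw gw; apply: uq => //.
  by move: gw; rewrite -/(isSome _) gE /is_true; case: (f w).
rewrite hears_None // => w evw.
have := gE w; case E: (f w) => [z|]; last by case: (g w).
have wu : w = u by apply: uq => //; rewrite E.
by move: E; rewrite wu fu => -[<-]; rewrite bit; case: (g u).
Qed.

(** The accumulator is claimed correct only where a message is heard. Elsewhere stray packets may
    leave garbage in it, which the header discards at the end. *)
Lemma iter_round_midway j : j <= width i ->
  exists2 a, (forall v y, hears e j f v = Some y -> a v = y) &
  iter j.+1 mround (fun v => Machine (i :: Q) (kappa v) (d v) 0 false 0) =
  if j == width i
  then fun v => Machine Q (step e i (fun v => head 0 (d v)) kappa v)
                        (behead (d v)) 0 false 0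
  else midway j.+1 a.
Proof.
have h0E v : isSome (@received V e B compile
    (fun v => Machine (i :: Q) (kappa v) (d v) 0 false 0) v) =
    isSome (hears e 0 f v).
  rewrite isSome_received; apply: isSome_hears => u.
  by rewrite /sending /= -/(f u); case: (f u).
have hjE j' v : isSome (hears e j' f v) = isSome (hears e 0 f v).
  exact: isSome_hears.
have updE k a v : machine_update (midway k.+1 a v)
    (@received V e B compile (midway k.+1 a) v) =
    if k.+1 == width i
    then Machine Q (up i (kappa v) (head 0 (d v))
           (if isSome (hears e 0 f v) then
              Some (a v + isSome (@received V e B compile (midway k.+1 a) v) * 2 ^ k)
            else None)) (behead (d v)) 0 false 0
    else Machine (i :: Q) (kappa v) (d v) k.+2 (isSome (hears e 0 f v))
           (a v + isSome (@received V e B compile (midway k.+1 a) v) * 2 ^ k).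
  by [].
have stepE k a : k == width i -> (forall v y, hears e k f v = Some y -> a v = y) ->
    forall v, up i (kappa v) (head 0 (d v))
      (if isSome (hears e 0 f v) then Some (a v) else None) =
    step e i (fun v => head 0 (d v)) kappa v.
  move=> /eqP kE aE v; rewrite /step -kE -(hjE k) -/f; congr up.
  by case E: (hears e k f v) => [y|] //=; rewrite (aE _ _ E).
elim: j => [|j IH] lej.
  have aE v y : hears e 0 f v = Some y -> 0 = y.
    by case/hearsP=> _ [u [x [_ _ -> _]]]; rewrite modn1.
  exists (fun=> 0) => //; rewrite /= /round /=.
  case: ifP => w0; apply: funext => v; rewrite /machine_update /= h0E w0 //.
  by rewrite (stepE 0 (fun=> 0)).
have [a aE itE] := IH (ltnW lej); rewrite iterS itE ltn_eqF //.
pose a' v := a v + isSome (@received V e B compile (midway j.+1 a) v) * 2 ^ j.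
have a'E v y : hears e j.+1 f v = Some y -> a' v = y.
  case/hearsP=> fv [u [x [evu fu -> uq]]]; rewrite /a' (received_midway _ _ fv evu fu uq).
  rewrite modn_exp2S; congr (_ + _); apply: aE; apply/hearsP; split=> //.
  by exists u, x.
exists a' => //; rewrite /round /=; case: ifP => w0; apply: funext => v.
  by rewrite updE w0 -(stepE j.+1 a').
by rewrite updE w0.
Qed.

Lemma iter_round_instr :
  iter (width i).+1 mround (fun v => Machine (i :: Q) (kappa v) (d v) 0 false 0) =
  fun v => Machine Q (step e i (fun v => head 0 (d v)) kappa v) (behead (d v)) 0 false 0.
Proof. by have [a _ ->] := iter_round_midway (leqnn _); rewrite eqxx. Qed.

End Instruction.

Lemma iter_round_program Q d kappa :
  exists d', iter (duration Q) mround (fun v => Machine Q (kappa v) (d v) 0 false 0) =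
             fun v => Machine [::] (run Q d kappa v) (d' v) 0 false 0.
Proof.
elim: Q d kappa => [|i Q IH] d kappa.
  by rewrite /duration big_nil; exists d.
rewrite /duration big_cons addnC iterD iter_round_instr; exact: IH.
Qed.

Local Open Scope ring_scope.

(** A uniform tuple of draws per node amounts to independent draws instruction by instruction:
    [glue] and [cut] split off the first draw of every node. *)
Lemma wp_run Q (f : (V -> S) -> rat) kappa :
  (\sum_(w : {ffun V -> (size Q).-tuple 'I_(2 ^ m)})
      f (run Q (fun v => [seq val c | c <- w v]) kappa))
    / #|{: {ffun V -> (size Q).-tuple 'I_(2 ^ m)}}|%:R = wp e m Q f kappa.
Proof.
elim: Q kappa => [|i Q IH] kappa /=.
  rewrite sumr_const -[X in X / _]mulr_natr mulfK // card_ffun card_tuple expn0 exp1n.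
  by rewrite oner_neq0.
rewrite /expectation.
under [in RHS]eq_bigr do rewrite -IH.
rewrite -mulr_suml -mulrA -invfM -natrM; congr (_ / _%:R); last first.
  by rewrite !card_ffun !card_tuple expnS expnMn card_ord mulnC.
rewrite pair_big /=.
pose glue (p : coins V m * {ffun V -> (size Q).-tuple 'I_(2 ^ m)}) :
  {ffun V -> (size Q).+1.-tuple 'I_(2 ^ m)} := [ffun v => [tuple of p.1 v :: p.2 v]].
pose cut (w : {ffun V -> (size Q).+1.-tuple 'I_(2 ^ m)}) :
  coins V m * {ffun V -> (size Q).-tuple 'I_(2 ^ m)} :=
  ([ffun v => thead (w v)], [ffun v => [tuple of behead (w v)]]).
rewrite (reindex glue) /=; last first.
  exists cut => [[c w] _|w _] /=.
    congr (_, _); apply/ffunP => v; rewrite !ffunE //.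
    by apply: val_inj.
  by apply/ffunP => v; rewrite !ffunE /= -tuple_eta.
apply: eq_bigr => -[c w] _; congr f; congr run.
  by apply: funext => v; rewrite /glue ffunE.
by congr step; apply: funext => v; rewrite /glue ffunE.
Qed.

Definition gst_outputs (out : V -> node_output) : bool :=
  let rk := fun v => out_rank (out v) in
  [exists par : {ffun V -> option V},
     is_GST e s par rk &&
     [forall u : V,
        (out_level (out u) == dist e s u) &&
        (out_parent (out u) == omap (fun v => (id v, rk v)) (par u))]].

Lemma success_probability_compile :
  success_probability e s id compile =
  pr e m P (fun tau => gst_outputs (fun v => outp (tau v)))
     (fun v => ini (id v) (v == s)).
Proof.
rewrite /pr -wp_run /success_probability; congr (_ / _).
rewrite -sum1_card natr_sum big_mkcond /=; apply: eq_bigr => w _.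
rewrite inE asboolb; set b := constructs_GST _ _ _ _; set b' := gst_outputs _.
suff -> : b = b' by case: b'.
have -> : b = gst_outputs (final_output (P := compile) e s id w) by [].
rewrite /b'; congr gst_outputs; apply: funext => v.
rewrite /final_output /start /=.
by have [d' ->] := iter_round_program P (fun v => [seq val c | c <- w v])
                     (fun v => ini (id v) (v == s)).
Qed.

End Compilation.

(** * Distances and shortest paths *)

Section Distance.

Variables (V : finType) (e : rel V).
Hypothesis e_conn : connected_graph e.

Lemma dist_le_size x p : path e x p -> dist e x (last x p) <= size p.
Proof.
move=> ep; rewrite /dist; set a := fun k => _.
(* A failing [find] returns the length [#|V|] of the list, so [dist] never exceeds the size of a
   path that long. *)
have [le|lt] := leqP #|V| (size p).
  by apply: leq_trans le; rewrite -[leqRHS](size_iota 0) find_size.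
rewrite leqNgt; apply/negP => /(before_find 0); rewrite nth_iota // add0n.
move=> af; suff : a (size p) by rewrite af.
by apply/existsP; exists (in_tuple p); rewrite /= ep eqxx.
Qed.

Lemma dist_path x y :
  exists p, [/\ path e x p, last x p = y & size p = dist e x y].
Proof.
have /connectP[p0 ep0 ->] := e_conn x y.
case: (shortenP ep0) => p ep up _.
set a := fun k => [exists q : k.-tuple V, path e x q && (last x q == last x p)].
have ltp : size p < #|V|.
  by rewrite -[(size p).+1]/(size (x :: p)) -(card_uniqP up) max_card.
have ha : has a (iota 0 #|V|).
  apply/hasP; exists (size p); first by rewrite mem_iota.
  by apply/existsP; exists (in_tuple p); rewrite /= ep eqxx.
have := nth_find 0 ha; rewrite nth_iota; last first.
  by rewrite -{2}(size_iota 0 #|V|) -has_find.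
case/existsP=> q /andP[eq /eqP lq].
by exists q; split=> //; rewrite size_tuple.
Qed.

Lemma dist_xx x : dist e x x = 0.
Proof. by apply/eqP; rewrite -leqn0; apply: (@dist_le_size x [::]). Qed.

Lemma dist_eq0 x y : dist e x y = 0 -> y = x.
Proof. by have [[|z p] [_ <- //= <-]] := dist_path x y. Qed.

Lemma dist_edge s u v : e u v -> dist e s v <= (dist e s u).+1.
Proof.
move=> euv; have [p [ep lp <-]] := dist_path s u.
have := @dist_le_size s (rcons p v); rewrite last_rcons size_rcons; apply.
by rewrite rcons_path ep lp.
Qed.

Lemma dist_pred s v d : dist e s v = d.+1 -> exists2 w, e w v & dist e s w = d.
Proof.
move=> dv; have [p [ep lp sp]] := dist_path s v; rewrite dv in sp.
case/lastP: p ep lp sp => [|p w] //.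
rewrite rcons_path last_rcons size_rcons => /andP[ep ew] wv [sp]; subst w.
exists (last s p) => //; apply/eqP; rewrite eqn_leq -{1}sp dist_le_size //=.
by rewrite -ltnS -dv dist_edge.
Qed.

Lemma dist_le_diameter x y : dist e x y <= diameter e.
Proof.
apply: leq_trans (leq_bigmax_cond (F := fun x => \max_y dist e x y) x _) => //.
exact: (leq_bigmax_cond (F := dist e x)).
Qed.

Lemma diameter_le_card : diameter e <= #|V|.
Proof.
apply/bigmax_leqP => x _; apply/bigmax_leqP => y _.
by rewrite -[leqRHS](size_iota 0) find_size.
Qed.

End Distance.

(* [dpar] is the id of a neighbor on the previous level, found while layering,
   [cpar] the id and rank of the parent; [rnk] stays None at leaves. *)
Record node := Node {
  cid         : nat;
  lvl         : option nat;
  dpar        : nat;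
  rnk         : option nat;
  cpar        : option (nat * nat);
  heard_probe : bool;
  active      : bool;
  cand        : bool;
  heard_count : bool;
  heard_reply : bool
}.

Definition rank (x : node) : nat := odflt 1 (rnk x).

(** * The program of a node *)

Section Algorithm.

(* Ids are below 2 ^ W and the number of nodes is below 2 ^ (L + 1). *)
Variables (L W T Dhat : nat).

(** Wake-up probabilities go down to [2 ^- (L + 3)]. A message of [X] bits holds an id of [W] bits
    and a rank, which stays below [2 ^ (L + 3)]. *)
Local Notation m := (L + 3).
Local Notation X := (W + (L + 3)).

Definition init_node (i : nat) (src : bool) : node :=
  Node i (if src then Some 0 else None) 0 None None false false false false false.

Definition output_node (x : node) : node_output :=
  NodeOutput (odflt 0 (lvl x)) (rank x) (cpar x).

Definition msg (b : bool) (y : nat) : option nat := if b then Some y else None.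

Definition layer_instr (d j : nat) : instr node :=
  Instr X
    (fun x k => msg ((lvl x == Some d) && (k < 2 ^ (m - j))) (cid x))
    (fun x k rx =>
       if (lvl x, rx) is (None, Some y)
       then Node (cid x) (Some d.+1) y (rnk x) (cpar x)
              (heard_probe x) (active x) (cand x) (heard_count x) (heard_reply x)
       else x).

Definition layering (d : nat) : seq (instr node) :=
  retry T [seq layer_instr d j | j <- iota 1 (L + 2)].

(* In the phase (t, r) the blue nodes, of rank r and on level t, choose their
   parents among the red nodes, on level t - 1. *)
Definition is_blue (t r : nat) (x : node) : bool :=
  [&& lvl x == Some t, rank x == r & cpar x == None].

Definition is_red (t : nat) (x : node) : bool := lvl x == Some t.-1.

Definition probe_instr (t r : nat) : instr node :=
  Instr 0
    (fun x k => msg (is_blue t r x) 0)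
    (fun x k rx => Node (cid x) (lvl x) (dpar x) (rnk x) (cpar x)
                     (isSome rx) false false false false).

(* A red node without a rank that received something from [probe_instr] has
   exactly one blue neighbor, and stays silent. *)
Definition wakes (t k j : nat) (x : node) : bool :=
  [&& is_red t x, isSome (rnk x) || ~~ heard_probe x & k < 2 ^ (m - j)].

Definition wake_instr (t j : nat) : instr node :=
  Instr 0
    (fun x k => msg (wakes t k j x) 0)
    (fun x k rx => Node (cid x) (lvl x) (dpar x) (rnk x) (cpar x)
                     (heard_probe x) (wakes t k j x) (isSome rx) (heard_count x) (heard_reply x)).

Definition count_instr (t r : nat) : instr node :=
  Instr 0
    (fun x k => msg (is_blue t r x && cand x) 0)
    (fun x k rx => Node (cid x) (lvl x) (dpar x) (rnk x) (cpar x)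
                     (heard_probe x) (active x) (cand x) (isSome rx) (heard_reply x)).

Definition reply_instr (t r j : nat) : instr node :=
  Instr 0
    (fun x k => msg [&& is_blue t r x, cand x & k < 2 ^ (m - j)] 0)
    (fun x k rx => Node (cid x) (lvl x) (dpar x) (rnk x) (cpar x)
                     (heard_probe x) (active x) (cand x) (heard_count x) (heard_reply x || isSome rx)).

(* Some candidate replied ([heard_reply]) and the candidates were not just one
   ([~~ heard_count]), so there are at least two. *)
Definition new_rank (r : nat) (x : node) : option nat :=
  if rnk x is Some q then Some q
  else if active x && (heard_reply x && ~~ heard_count x) then Some r.+1 else None.

(** The pair of rank and id travels as [rank * 2 ^ W + id]. A candidate that hears nothing stays
    without a parent, hence blue. *)
Definition recruit_instr (t r : nat) : instr node :=
  Instr X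
    (fun x k => msg (active x && isSome (new_rank r x))
                  (odflt 0 (new_rank r x) * 2 ^ W + cid x))
    (fun x k rx =>
       Node (cid x) (lvl x) (dpar x) (new_rank r x)
         (if is_blue t r x && cand x then
            if rx is Some y then Some (y %% 2 ^ W, y %/ 2 ^ W) else None
          else cpar x)
         (heard_probe x) (active x) (cand x) (heard_count x) (heard_reply x)).

Definition attempt (t r j : nat) : seq (instr node) :=
  [:: probe_instr t r; wake_instr t j; count_instr t r] ++
  ([seq reply_instr t r j' | j' <- iota 1 (L + 2)] ++ [:: recruit_instr t r]).

(** Blue nodes announce the neighbor they found while layering; a red node that hears its own id
    learns that it has been chosen. *)
Definition settle_instr (t r : nat) : instr node :=
  Instr X
    (fun x k => msg (is_blue t r x) (dpar x))
    (fun x k rx =>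
       Node (cid x) (lvl x) (dpar x)
         (if rnk x is Some q then Some q
          else if is_red t x && (rx == Some (cid x)) then Some r else None)
         (if is_blue t r x then Some (dpar x, r) else cpar x)
         (heard_probe x) (active x) (cand x) (heard_count x) (heard_reply x)).

(** Scale [k] is for live degrees below [d = 2 ^ k]; its wake-up probability [2 ^- (k + 2)] is
    [1 / (4 d)]. When scale 1 has succeeded, no blue node has a live neighbor and settling is
    safe. *)
Definition phase (t r : nat) : seq (instr node) :=
  downfrom L.+1 (fun k => retry T (attempt t r k.+2)) ++ [:: settle_instr t r].

Definition program : seq (instr node) :=
  upto Dhat layering ++ downfrom Dhat (fun t => downfrom L.+1 (phase t)).

(** * Decay and the computation of levels *)

Section Analysis.

Variables (V : finType) (e : rel V) (s : V) (id : V -> nat).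
Hypothesis e_sym : symmetric e.
Hypothesis e_conn : connected_graph e.
Hypothesis id_inj : injective id.
Hypothesis id_lt : forall v, id v < 2 ^ W.
Hypothesis card_lt : #|V| < 2 ^ L.+1.
Hypothesis dist_Dhat : forall v, dist e s v <= Dhat.

Local Notation D := (dist e s).
Local Notation cfg := (V -> node).

Implicit Types (sigma tau : cfg).

Lemma id_mod v : id v %% 2 ^ X = id v.
Proof.
by rewrite modn_small // (leq_trans (id_lt v)) // leq_exp2l // leq_addr.
Qed.

Local Open Scope ring_scope.

(* Decay: some transmission probability 2 ^- j with j <= L + 2 is within a
   factor 2 of 1 / (2 * #|A|). *)
Lemma decay (A : {set V}) : (0 < #|A|)%N ->
  exists2 j, j \in iota 1 (L + 2) &
  forall f : coins V m -> rat, (forall c, 0 <= f c) ->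
    (forall c v, v \in A -> isolated j v (A :\ v) c -> 1 <= f c) ->
  8%:R^-1 <= expectation f.
Proof.
move=> A0; pose j := (trunc_log 2 #|A|).+2.
have le1 : (2 ^ trunc_log 2 #|A| <= #|A|)%N by apply: trunc_logP.
have lt1 : (#|A| < 2 ^ (trunc_log 2 #|A|).+1)%N by apply: trunc_log_ltn.
have jL : (trunc_log 2 #|A| <= L)%N.
  rewrite -ltnS -(@ltn_exp2l 2) //; apply: leq_ltn_trans le1 _.
  exact: leq_ltn_trans (max_card _) card_lt.
exists j; first by rewrite mem_iota /j; lia.
move=> f f0 Hf.
have := @isolation V m j #|A| A (fun v => A :\ v) 1 f.
rewrite mul1r => /(_ _ ler01 f0) H; apply: le_trans (H _ _ _ _ Hf) => //.
(* With [y = #|A| * 2 ^- j], isolation gives [y * (1 - y)], and the choice of [j] puts [y] between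
   1/4 and 1/2. *)
- set x := 2%:R ^- j; set a : rat := #|A|%:R.
  have x0 : 0 < x by rewrite invr_gt0 exprn_gt0.
  have jE : (2 ^ j = 4 * 2 ^ trunc_log 2 #|A|)%N by rewrite /j !expnS mulnA.
  have Ex : x * (2 ^ j)%:R = 1 by rewrite natrX mulVf // expf_neq0.
  have h1 : 4%:R^-1 <= a * x.
    have : ((2 ^ j)%:R : rat) <= 4%:R * a by rewrite -natrM ler_nat jE leq_mul2l le1.
    move=> /(ler_wpM2l (ltW x0)); rewrite Ex; lra.
  have h2 : a * x <= 2%:R^-1.
    have : 2%:R * a <= ((2 ^ j)%:R : rat).
      by rewrite -natrM ler_nat /j expnS leq_mul2l ltnW.
    move=> /(ler_wpM2l (ltW x0)); rewrite Ex; lra.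
  move: (a * x) h1 h2 => y; nra.
- by rewrite /j; lia.
- by move=> v vA; rewrite !inE eqxx.
- by move=> v vA; rewrite subset_leq_card // subsetDl.
Qed.

(** Bound for [T] trials of success probability 1/128, the guarantee for an attempt. Decay sweeps,
    with 1/8, are charged the same. *)
Definition failure : rat := (1 - 128%:R^-1) ^+ T.

Lemma failure_ge0 : 0 <= failure.
Proof. by apply: exprn_ge0; lra. Qed.

Lemma isolated_in j u (A : {set V}) (c : coins V m) w :
  isolated j u (A :\ u) c -> w \in A -> (c w < 2 ^ (m - j))%N -> w = u.
Proof.
case/andP=> _ /forall_inP iso wA cw; apply/eqP; apply: contraLR cw => wu.
by apply: iso; rewrite !inE wu.
Qed.

(** An invariant that also holds between the sweeps for level [d]: level [d.+1] may be partly
    discovered, so both alternatives allow it. *)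
Definition layered (d : nat) sigma : Prop := forall v,
  [/\ cid (sigma v) = id v, rnk (sigma v) = None, cpar (sigma v) = None,
      (lvl (sigma v) = Some (D v) /\ (D v <= d.+1)%N) \/
      (lvl (sigma v) = None /\ (d < D v)%N) &
      lvl (sigma v) <> None -> v <> s ->
      exists w, [/\ e w v, D v = (D w).+1 & dpar (sigma v) = id w]].

Lemma layered_lvl d sigma v : layered d sigma ->
  (lvl (sigma v) == Some d) = (D v == d).
Proof.
move=> /(_ v)[_ _ _ [[-> _]|[-> lt]] _]; first by rewrite (inj_eq Some_inj).
by rewrite gtn_eqF.
Qed.

Lemma layered_step d j (c : coins V m) sigma :
  layered d sigma -> layered d (cstep e (layer_instr d j) c sigma).
Proof.
move=> H v; have [idv rv pv lv dv] := H v; rewrite /cstep /step /=.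
case E: (hears _ _ _ _) => [y|]; last by case: (lvl (sigma v)) => [k|]; exact: H.
case El: (lvl (sigma v)) => [k|]; first exact: H.
case/hearsP: E => _ [u [x [evu]]]; rewrite /msg layered_lvl //.
case: ifP => // /andP[/eqP Du _] [<-] -> _.
have [idu _ _ _ _] := H u.
have Dv : D v = d.+1.
  apply/eqP; rewrite eqn_leq -{1}Du dist_edge // 1?e_sym //=.
  by case: lv => [[] |[]]; rewrite ?El.
split; rewrite //= ?Dv; first by left.
by move=> _ _; exists u; rewrite e_sym evu Du idu id_mod.
Qed.

Lemma hoare_layering d :
  hoare e m (layered d) (layering d) (layered d.+1) (#|V|%:R * failure).
Proof.
pose B v (sigma : cfg) := (D v <= d.+1)%N -> lvl (sigma v) <> None.
have As sigma : layered d sigma ->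
    surely e m [seq layer_instr d j | j <- iota 1 (L + 2)] (layered d) sigma.
  by apply: surely_map => j c tau; apply: layered_step.
have Bst v j (c : coins V m) sigma : B v sigma -> B v (cstep e (layer_instr d j) c sigma).
  move=> Bv le; have := Bv le; rewrite /cstep /step /=.
  by case E: (lvl (sigma v)) => [k|] //; rewrite E.
apply: (@hoare_weaken _ _ _ _ (layered d) _
  (fun tau => (forall v, B v tau) /\ layered d tau)).
- by [].
- move=> tau [BH H] v; have [? ? ? lv dv] := H v; have Bv := BH v.
  split=> //; case: lv => [[lv le]|[lv lt]].
    by left; split=> //; apply: leqW.
  by right; split=> //; rewrite ltnNge; apply/negP => /Bv; apply.
apply: hoare_and_surely; first exact: surely_retry.
apply: hoare_forall => v sigma Hs.
apply: le_trans (_ : (1 - 8%:R^-1) ^+ T <= _); last first.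
  by apply: lerXn2r; rewrite ?nnegrE; lra.
apply: (@pr_retry _ _ _ _ _ _ (layered d) (B v)) Hs; [lra|exact: As| |].
  by move=> tau _ Bt; apply: surely_map Bt => j c tau' ; apply: Bst.
move=> tau Ht nB.
have {nB} [le lv] : (D v <= d.+1)%N /\ lvl (tau v) = None.
  by apply: contra_notP nB => H le lv; apply: H.
have Dv : D v = d.+1.
  apply/eqP; rewrite eqn_leq le /=.
  by case: (Ht v) => _ _ _ [[]|[]]; rewrite ?lv.
(* Under [layered d] only nodes of level [d] transmit, so a node isolated within [A] delivers its id
   to [v]. *)
pose A := [set u | e v u && (D u == d)].
have A0 : (0 < #|A|)%N.
  have [w ew Dw] := dist_pred e_conn Dv.
  by apply/card_gt0P; exists w; rewrite inE e_sym ew Dw eqxx.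
have [j jL Hj] := decay A0.
apply: (@pr_map _ _ _ _ _ _ _ j (layered d)) Ht => //.
- by move=> j' c tau'; apply: layered_step.
- by move=> j' c tau' _; apply: Bst.
move=> tau' Ht'; apply: Hj => // c u; rewrite inE => /andP[evu /eqP Du] iso.
rewrite asboolT // => _; rewrite /cstep /step /=.
case El: (lvl (tau' v)) => [k|] /=; first by rewrite El.
suff -> : hears e X (fun w => tx (layer_instr d j) (tau' w) (c w)) v =
          Some (cid (tau' u) %% 2 ^ X)%N by [].
apply/hearsP; split; first by rewrite /= /msg El.
exists u, (cid (tau' u)); split=> //= [|w evw].
  by rewrite /msg layered_lvl // Du eqxx; case/andP: iso => ->.
rewrite /msg layered_lvl //; case: ifP => // /andP[/eqP Dw cw] _.
by apply: (isolated_in iso) => //; rewrite inE evw Dw eqxx.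
Qed.

(** * The partial tree and the bound on ranks *)

Local Open Scope nat_scope.

(** The two ways in which the ranking rule yields [q] at an internal node: a tie at the maximum
    [q - 1], or a unique maximum [q]. *)
Definition ranked_by_children sigma (v : V) (q : nat) : Prop :=
  let kid u := cpar (sigma u) = Some (id v, q) in
  (exists u1 u2, [/\ u1 <> u2, kid u1, kid u2,
     (rank (sigma u1)).+1 = q & (rank (sigma u2)).+1 = q] /\
     forall u, kid u -> rank (sigma u) < q) \/
  (exists u, [/\ kid u, rank (sigma u) = q &
     forall u', kid u' -> u' <> u -> rank (sigma u') < q]).

(* The part of the tree built when the nodes below level t, and those of rank
   above r on level t, have their parents. *)
Record gathered (t r : nat) sigma : Prop := Gathered {
  g_cid : forall v, cid (sigma v) = id v;
  g_lvl : forall v, lvl (sigma v) = Some (D v);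
  g_dpar : forall v, v <> s ->
    exists w, [/\ e w v, D v = (D w).+1 & dpar (sigma v) = id w];
  g_par : forall u p, cpar (sigma u) = Some p -> exists v,
    [/\ p = (id v, rank (sigma v)), rnk (sigma v) <> None, e v u,
        D u = (D v).+1 & t < D u \/ (D u = t /\ r <= rank (sigma u))];
  g_done : forall u, t < D u \/ (D u = t /\ r < rank (sigma u)) ->
    cpar (sigma u) <> None;
  g_rank : forall v q, rnk (sigma v) = Some q ->
    [/\ 0 < q, t <= (D v).+1, (D v).+1 = t -> r < q &
        ranked_by_children sigma v q];
  g_free : forall u1 u2 v1 v2 q, v1 <> v2 ->
    cpar (sigma u1) = Some (id v1, q) -> cpar (sigma u2) = Some (id v2, q) ->
    rank (sigma u1) = q -> rank (sigma u2) = q -> D u1 = D u2 -> ~~ e v1 u2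
}.

Lemma rankE sigma v q : rnk (sigma v) = Some q -> rank (sigma v) = q.
Proof. by rewrite /rank => ->. Qed.

Lemma rank_gt0 t r sigma v : gathered t r sigma -> 0 < rank (sigma v).
Proof. by move=> H; rewrite /rank; case E: rnk => [q|] //=; case: (g_rank H E). Qed.

Lemma g_kid t r sigma u v q : gathered t r sigma ->
  cpar (sigma u) = Some (id v, q) ->
  [/\ rnk (sigma v) = Some q, e v u, D u = (D v).+1 &
      t < D u \/ (D u = t /\ r <= rank (sigma u))].
Proof.
move=> H /(g_par H)[v' [[/id_inj <- ->] nN ev Du tu]]; split=> //.
by rewrite /rank; case: (rnk (sigma v)) nN.
Qed.

(** Two children of rank [q - 1], or one of rank [q], already weigh [2 ^ (q - 1)] together. The
    summand 1 covers the nodes of default rank 1. *)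
Lemma exp_rank_le t r sigma v : gathered t r sigma ->
  2 ^ (rank (sigma v)).-1 <=
  1 + \sum_(u | cpar (sigma u) == Some (id v, rank (sigma v)))
        2 ^ (rank (sigma u)).-1.
Proof.
move=> H; case E: (rnk (sigma v)) => [q|]; last by rewrite {1}/rank E leq_addr.
rewrite (rankE E); have [q0 _ _ [|]] := g_rank H E.
  case=> u1 [u2 [[ne k1 k2 r1 r2] _]].
  rewrite (bigD1 u1) /= ?k1 // (bigD1 u2) /= ?k2 ?eqxx /=; last first.
    by apply/eqP => E12; apply: ne.
  have [e1 e2] : rank (sigma u1) = q.-1 /\ rank (sigma u2) = q.-1.
    by split; [rewrite -r1|rewrite -r2].
  have : 0 < q.-1 by rewrite -e1 (rank_gt0 _ H).
  rewrite e1 e2; case: q {E q0 k1 k2 r1 r2 e1 e2} => [|[|q]] // _ /=.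
  by rewrite expnS; lia.
case=> u [ku ru _].
by rewrite (bigD1 u) /= ?ku // ru; lia.
Qed.

(** Induction from the deepest level upwards: passing to the children costs 1 per node, and a node
    of level [j.+1] is charged by at most one parent. *)
Lemma level_weight_le t r sigma j : gathered t r sigma ->
  \sum_(v | D v == j) 2 ^ (rank (sigma v)).-1 <= #|[pred v | j <= D v]|.
Proof.
move=> H; have [k] : exists k, Dhat < j + k by exists Dhat.+1; lia.
elim: k j => [|k IH] j lt.
  rewrite big1 // => v /eqP Dv; have := dist_Dhat v; lia.
apply: (@leq_trans (\sum_(v | D v == j) (1 +
  \sum_(u | cpar (sigma u) == Some (id v, rank (sigma v))) 2 ^ (rank (sigma u)).-1))).
  by apply: leq_sum => v _; apply: exp_rank_le H.
rewrite big_split /= sum1_card.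
have -> : #|[pred v | j <= D v]| = #|[pred v | D v == j]| + #|[pred v | j.+1 <= D v]|.
  rewrite -(cardID [pred v | D v == j] [pred v | j <= D v]).
  by congr (_ + _); apply: eq_card => v; rewrite !inE; case: ltngtP.
rewrite leq_add2l; apply: leq_trans (IH j.+1 _); last by rewrite addSnnS.
rewrite (exchange_big_dep (fun u => D u == j.+1)) /=; last first.
  by move=> v u /eqP Dv /eqP /(g_kid H)[_ _ -> _]; rewrite Dv.
apply: leq_sum => u _.
case: (pickP [pred v | (D v == j) &&
    (cpar (sigma u) == Some (id v, rank (sigma v)))]) => [v0 /= P0|none].
  rewrite (bigD1 v0) //= big_pred0 ?addn0 // => v.
  apply/negbTE/negP => /andP[/andP[_ /eqP kv] /eqP]; apply; apply: id_inj.
  by case/andP: P0 => _; rewrite kv => /eqP[].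
by rewrite big_pred0.
Qed.

Lemma rank_le t r sigma v : gathered t r sigma -> rank (sigma v) <= L.+1.
Proof.
move=> H; have := level_weight_le (D v) H; rewrite (bigD1 v) //= => le.
have : 2 ^ (rank (sigma v)).-1 < 2 ^ L.+1.
  apply: leq_ltn_trans card_lt; apply: leq_trans (leq_trans le (max_card _)).
  exact: leq_addr.
by rewrite ltn_exp2l //; case: rank.
Qed.

Lemma gathered_layered sigma : layered Dhat sigma -> gathered Dhat L.+1 sigma.
Proof.
move=> H; have nlt v : Dhat < D v -> False by have := dist_Dhat v; lia.
have lv v : lvl (sigma v) = Some (D v).
  by case: (H v) => _ _ _ [[-> _]|[_ /nlt []]] _.
have rv v : rnk (sigma v) = None by case: (H v).
have pv v : cpar (sigma v) = None by case: (H v).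
split=> [v|//|v vs|u p|u|v q|u1 u2 v1 v2 q _].
- by case: (H v).
- by case: (H v) => _ _ _ _; apply=> //; rewrite lv.
- by rewrite pv.
- by case=> [/nlt|[_]] //; rewrite /rank rv.
- by rewrite rv.
- by rewrite pv.
Qed.

(** Ranks lie between 1 and [L.+1], so the bound 0 makes [g_done] cover all of level [t.+1], and the
    bound [L.+1] makes it ask nothing of level [t]. *)
Lemma gathered_next_level t sigma :
  gathered t.+1 0 sigma -> gathered t L.+1 sigma.
Proof.
move=> H; split; try by case: H.
- move=> u p /(g_par H)[v [pE nN ev Du tu]]; exists v; split=> //; left; lia.
- move=> u tu; apply: (g_done H); case: tu => [lt|[_ lt]].
    have := rank_gt0 u H; move: lt; lia.
  have := rank_le u H; lia.
- by move=> v q /(g_rank H)[q0 tv _ rv]; split=> //; lia.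
Qed.

(** * What an attempt may do to the partial tree *)

Record joined (t r : nat) sigma tau : Prop := Joined {
  j_same : forall v, [/\ cid (tau v) = cid (sigma v), lvl (tau v) = lvl (sigma v)
                       & dpar (tau v) = dpar (sigma v)];
  j_rnk : forall v, rnk (tau v) = rnk (sigma v) \/
    [/\ rnk (sigma v) = None, (D v).+1 = t, rnk (tau v) = Some r.+1 &
        exists u1 u2, [/\ u1 <> u2, is_blue t r (sigma u1), is_blue t r (sigma u2),
          cpar (tau u1) = Some (id v, r.+1) & cpar (tau u2) = Some (id v, r.+1)]];
  j_par : forall u, cpar (tau u) = cpar (sigma u) \/
    (is_blue t r (sigma u) /\ exists v, [/\ e v u, (D v).+1 = t,
       rnk (tau v) <> None & cpar (tau u) = Some (id v, rank (tau v))])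
}.

Lemma blueP t r sigma u : gathered t r sigma -> is_blue t r (sigma u) ->
  [/\ D u = t, rank (sigma u) = r & cpar (sigma u) = None].
Proof.
by move=> H /and3P[/eqP]; rewrite (g_lvl H) => -[->] /eqP -> /eqP ->.
Qed.

Lemma blueI t r t' r' sigma u : gathered t' r' sigma ->
  D u = t -> rank (sigma u) = r -> cpar (sigma u) = None -> is_blue t r (sigma u).
Proof. by move=> H Du ru pu; rewrite /is_blue (g_lvl H) Du ru pu !eqxx. Qed.

Lemma rank_Some (x : node) : rnk x <> None -> rnk x = Some (rank x).
Proof. by rewrite /rank; case: (rnk x). Qed.

Section Joined.

Variables (t r : nat) (sigma tau : cfg).
Hypotheses (G : gathered t r sigma) (J : joined t r sigma tau).

Lemma joined_rank u : t <= D u -> rank (tau u) = rank (sigma u).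
Proof. by move=> le; rewrite /rank; case: (j_rnk J u) => [->//|[_ Du]]; lia. Qed.

Lemma joined_rnk v q : rnk (sigma v) = Some q -> rnk (tau v) = Some q.
Proof. by case: (j_rnk J v) => [->//|[->]]. Qed.

Lemma joined_kid u v q : cpar (tau u) = Some (id v, q) ->
  cpar (sigma u) = Some (id v, q) \/
  [/\ is_blue t r (sigma u), e v u, (D v).+1 = t & rnk (tau v) = Some q].
Proof.
case: (j_par J u) => [->|[bu [v' [ev Dv nN ->]]] [/id_inj <- <-]]; first by left.
by right; split=> //; apply: rank_Some.
Qed.

Lemma joined_rnk_gt v q : (D v).+1 = t -> rnk (tau v) = Some q -> r < q.
Proof.
move=> Dv; case: (j_rnk J v) => [->|[_ _ -> _ [<-]]] //.
by move=> /(g_rank G)[_ _ ->].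
Qed.

Lemma kid_level u v q : cpar (sigma u) = Some (id v, q) -> t <= D u.
Proof. by move=> /(g_kid G)[_ _ _ [/ltnW|[->]]]. Qed.

(** An adopted node has rank [r] and its parent a larger one. So it disturbs neither the rank of a
    parent already ranked nor collision-freeness, which concerns children of their parent's rank; a
    newly ranked parent has at least two children, all of rank [r]. *)
Lemma joined_gathered : gathered t r tau.
Proof.
split.
- by move=> v; have [-> _ _] := j_same J v; apply: (g_cid G).
- by move=> v; have [_ -> _] := j_same J v; apply: (g_lvl G).
- move=> v vs; have [_ _ ->] := j_same J v; exact: (g_dpar G).
- move=> u p; case: (j_par J u) => [->|[bu [v [ev Dv nN ->]]] [<-]].
    move=> /(g_par G)[v [pE /rank_Some rv ev Du tu]]; exists v.
    have rv' := joined_rnk rv.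
    rewrite (rankE rv') rv'; split=> //; case: tu => [|[Dt le]]; first by left.
    by right; rewrite joined_rank // Dt.
  have [Du ru pu] := blueP G bu; exists v; split=> //; first by rewrite Du.
  by right; rewrite joined_rank ?Du // ru.
- move=> u tu; have : cpar (sigma u) <> None.
    apply: (g_done G); case: tu => [|[Du]]; first by left.
    by rewrite joined_rank ?Du //; right.
  by case: (j_par J u) => [->|[_ [v [_ _ _ ->]]]].
- move=> v q rv; case: (j_rnk J v) => [E|[rN Dv E [u1 [u2 [ne b1 b2 p1 p2]]]]].
    have rs : rnk (sigma v) = Some q by rewrite -E.
    have [q0 tv tq rc] := g_rank G rs; split=> //.
    have new u : cpar (tau u) = Some (id v, q) -> cpar (sigma u) <> Some (id v, q) ->
        rank (tau u) < q.
      move=> /joined_kid[//|[bu _ Dv _]] _; have [Du ru _] := blueP G bu.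
      by rewrite joined_rank ?Du // ru; apply: tq.
    have old u : cpar (sigma u) = Some (id v, q) ->
        cpar (tau u) = Some (id v, q) /\ rank (tau u) = rank (sigma u).
      move=> k; rewrite joined_rank ?(kid_level k) //; split=> //.
      by case: (j_par J u) => [->//|[/(blueP G)[_ _]]]; rewrite k.
    case: rc => [[u1 [u2 [[ne k1 k2 r1 r2] lt]]]|[u [ku ru lt]]].
      have [k1' r1'] := old _ k1; have [k2' r2'] := old _ k2.
      left; exists u1, u2; split; first by rewrite r1' r2'.
      move=> u ku; have [k|nk] := eqVneq (cpar (sigma u)) (Some (id v, q)).
        by have [_ ->] := old _ k; apply: lt.
      by apply: new => //; apply/eqP.
    have [ku' ru'] := old _ ku; right; exists u; split; rewrite ?ru' //.
    move=> u' k' ne; have [k|nk] := eqVneq (cpar (sigma u')) (Some (id v, q)).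
      by have [_ ->] := old _ k; apply: lt.
    by apply: new => //; apply/eqP.
  have qE : q = r.+1 by move: rv; rewrite E => -[].
  rewrite qE; split=> //; first by rewrite Dv.
  have kr u : cpar (tau u) = Some (id v, r.+1) -> rank (tau u) = r.
    case/joined_kid => [/(g_kid G)[]|[bu _ _ _]]; first by rewrite rN.
    by have [Du ru _] := blueP G bu; rewrite joined_rank ?Du.
  left; exists u1, u2; split; first by rewrite !kr.
  by move=> u /kr ->.
- move=> u1 u2 v1 v2 q nev k1 k2 r1 r2 Du.
  (* A child of its parent's rank cannot be new, since ranked nodes on level [t - 1] have rank above
     [r]. *)
  have old u v : cpar (tau u) = Some (id v, q) -> rank (tau u) = q ->
      cpar (sigma u) = Some (id v, q) /\ rank (sigma u) = q.
    move=> k; case: (joined_kid k) => [k' ru|[bu _ Dv rv] ru].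
      by split=> //; rewrite -joined_rank ?(kid_level k').
    have := joined_rnk_gt Dv rv; rewrite -ru.
    by have [Du' ru' _] := blueP G bu; rewrite joined_rank ?Du' // ru' ltnn.
  have [k1' r1'] := old _ _ k1 r1; have [k2' r2'] := old _ _ k2 r2.
  exact: (g_free G) k1' k2' r1' r2' Du.
Qed.

Lemma joined_blue u : is_blue t r (tau u) -> is_blue t r (sigma u).
Proof.
move=> /(blueP joined_gathered)[Du ru pu].
apply: (blueI G) => //; first by rewrite -joined_rank // Du.
by case: (j_par J u) => [<-//|[_ [v [_ _ _]]]]; rewrite pu.
Qed.

End Joined.

(** * Settling the remaining blue nodes *)

Section Settled.

Variables (t r : nat) (sigma tau : cfg).
Hypotheses (G : gathered t r.+1 sigma) (t0 : 0 < t).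

Local Notation blue u := (is_blue t r.+1 (sigma u)).

(** The situation left when no blue node has a live neighbor; [settle_gathered] derives it from live
    degrees below 1. *)
Hypothesis lone : forall u v, blue u -> e v u -> (D v).+1 = t ->
  rnk (sigma v) = None /\ forall u', blue u' -> e v u' -> u' = u.
Hypothesis same : forall v,
  [/\ cid (tau v) = cid (sigma v), lvl (tau v) = lvl (sigma v)
    & dpar (tau v) = dpar (sigma v)].
Hypothesis new_rnk : forall v, rnk (tau v) = rnk (sigma v) \/
  [/\ rnk (sigma v) = None, rnk (tau v) = Some r.+1 &
      exists u, blue u /\ dpar (sigma u) = id v].
Hypothesis settles : forall u v, blue u -> e v u -> (D v).+1 = t ->
  dpar (sigma u) = id v -> rnk (tau v) = Some r.+1.
Hypothesis new_par : forall u,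
  cpar (tau u) = if blue u then Some (dpar (sigma u), r.+1) else cpar (sigma u).

Lemma blue_dpar u : blue u ->
  exists v, [/\ dpar (sigma u) = id v, e v u & (D v).+1 = t].
Proof.
move=> bu; have [Du _ _] := blueP G bu; have [|v [ev Dv dv]] := g_dpar G (v := u).
  by move=> us; move: Du t0; rewrite us dist_xx // => <-.
by exists v; rewrite -Dv.
Qed.

Lemma settled_new v : rnk (tau v) = rnk (sigma v) \/
  [/\ rnk (sigma v) = None, rnk (tau v) = Some r.+1, (D v).+1 = t &
      exists u, [/\ blue u, e v u & dpar (sigma u) = id v]].
Proof.
case: (new_rnk v) => [|[rN rS [u [bu du]]]]; [by left|right].
have [v' [dv' ev Dv]] := blue_dpar bu; move: dv'; rewrite du => /id_inj vv'.
by rewrite -vv' in ev Dv; split=> //; exists u.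
Qed.

Lemma settled_rank u : t <= D u -> rank (tau u) = rank (sigma u).
Proof. by move=> le; rewrite /rank; case: (settled_new u) => [->//|[_ _ Du]]; lia. Qed.

Lemma settled_kid u v q : cpar (tau u) = Some (id v, q) ->
  [/\ blue u, e v u, (D v).+1 = t, q = r.+1 & dpar (sigma u) = id v] \/
  (~~ blue u /\ cpar (sigma u) = Some (id v, q)).
Proof.
rewrite new_par; case: ifP => [bu [du <-]|bu k]; [left|by right].
have [v' [dv' ev Dv]] := blue_dpar bu; move: dv'; rewrite du => /id_inj ->.
by [].
Qed.

(** By [lone], a parent chosen now gets a single child, of its own rank [r.+1], and no node ranked
    before gains a child, so earlier ranks stay justified. *)
Lemma settled_gathered : gathered t r tau.
Proof.
split.
- by move=> v; have [-> _ _] := same v; apply: (g_cid G).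
- by move=> v; have [_ -> _] := same v; apply: (g_lvl G).
- move=> v vs; have [_ _ ->] := same v; exact: (g_dpar G).
- move=> u p; rewrite new_par; case: ifP => [bu [<-]|_].
    have [v [dv ev Dv]] := blue_dpar bu; have [Du ru _] := blueP G bu.
    have rv := settles bu ev Dv dv.
    exists v; rewrite (rankE rv) rv dv Dv; split=> //.
    by right; rewrite settled_rank ?Du // ru.
  move=> /(g_par G)[v [pE /rank_Some rv ev Du tu]]; exists v.
  have rv' : rnk (tau v) = Some (rank (sigma v)).
    by case: (new_rnk v) => [->//|[]]; rewrite rv.
  rewrite (rankE rv') rv'; split=> //; case: tu => [|[Dt le]]; first by left.
  by right; rewrite settled_rank ?Dt //; split=> //; apply: ltnW.
- move=> u tu; rewrite new_par; case: ifP => // nb pN; case: tu => [lt|[Du]].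
    by apply: (g_done G _ pN); left.
  rewrite settled_rank ?Du // leq_eqVlt => /orP[/eqP ru|lt].
    by move: nb; rewrite (blueI G).
  by apply: (g_done G _ pN); right.
- move=> v q rv; case: (settled_new v) => [E|[rN E Dv [u [bu ev du]]]].
    have rs : rnk (sigma v) = Some q by rewrite -E.
    have [q0 tv tq rc] := g_rank G rs; split=> //.
      by move/tq; apply: ltnW.
    have old u : cpar (tau u) = Some (id v, q) <-> cpar (sigma u) = Some (id v, q).
      split=> [/settled_kid[[bu ev Dv _ _]|[]//]|k].
        by have [] := lone bu ev Dv; rewrite rs.
      rewrite new_par; case: ifP => // /(blueP G)[_ _].
      by rewrite k.
    have rk u : cpar (sigma u) = Some (id v, q) -> rank (tau u) = rank (sigma u).
      by move=> /(kid_level G); apply: settled_rank.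
    case: rc => [[u1 [u2 [[ne k1 k2 r1 r2] lt]]]|[u [ku ru lt]]].
      left; exists u1, u2; split; first by rewrite !rk //; split=> //; apply/old.
      by move=> u /old k; rewrite rk //; apply: lt.
    right; exists u; split; [exact/old|by rewrite rk|].
    by move=> u' /old k ne; rewrite rk //; apply: lt.
  have qE : q = r.+1 by move: rv; rewrite E => -[].
  rewrite qE; split=> //; first by rewrite Dv.
  have [Du ru _] := blueP G bu.
  right; exists u; split; first by rewrite new_par bu du.
    by rewrite settled_rank ?Du.
  move=> u' /settled_kid[[bu' ev' _ _ _] []|[_ /(g_kid G)[]]]; last by rewrite rN.
  by have [_] := lone bu ev Dv; apply.
- move=> u1 u2 v1 v2 q nev k1 k2 r1 r2 Du.
  have old u v : cpar (sigma u) = Some (id v, q) -> D u = t -> r.+1 < q.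
    by move=> /(g_kid G)[rv _ -> _] Dv; have [_ _ ->] := g_rank G rv.
  (* If both pairs are new, an edge from [v1] to [u2] would identify [u1] with [u2] by [lone], hence
     their parents. A new and an old pair cannot share [q]: old parents of nodes on level [t] have
     rank above [r.+1]. *)
  case: (settled_kid k1) => [[b1 ev1 Dv1 q1 d1]|[b1 k1']];
    case: (settled_kid k2) => [[b2 ev2 Dv2 q2 d2]|[b2 k2']].
  + apply/negP => ev12; have [_ /(_ _ b2 ev12) u12] := lone b1 ev1 Dv1.
    by apply: nev; apply: id_inj; rewrite -d1 -d2 u12.
  + have [Du1 _ _] := blueP G b1.
    by have := old _ _ k2'; rewrite -Du Du1 q1 ltnn => /(_ erefl).
  + have [Du2 _ _] := blueP G b2.
    by have := old _ _ k1'; rewrite Du Du2 q2 ltnn => /(_ erefl).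
  + apply: (g_free G nev k1' k2') => //.
      by rewrite -settled_rank // (kid_level G k1').
    by rewrite -settled_rank // (kid_level G k2').
Qed.

End Settled.

(** * From the final configuration to a GST *)

Lemma gathered_gst r sigma : gathered 0 r sigma ->
  gst_outputs e s id (fun v => output_node (sigma v)).
Proof.
move=> G.
(* Nodes store the id and rank of their parent; injectivity of [id] makes the node picked here
   unique. *)
pose par : {ffun V -> option V} :=
  [ffun u => [pick v | cpar (sigma u) == Some (id v, rank (sigma v))]].
have parP u v : (par u == Some v) = (cpar (sigma u) == Some (id v, rank (sigma v))).
  rewrite ffunE; case: pickP => [v' /eqP -> | none]; last by rewrite none.
  apply/eqP/eqP => [[<-]//|[/id_inj -> _] //].
have parN u : par u = None -> cpar (sigma u) = None.
  rewrite ffunE; case: pickP => // none _; case E: (cpar (sigma u)) => [p|] //.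
  by have [v [pE _ _ _ _]] := g_par G E; have := none v; rewrite E pE eqxx.
apply/existsP; exists par; apply/andP; split; last first.
  apply/forallP => u; rewrite /= (g_lvl G) eqxx /=.
  case E: (par u) => [v|] /=; last by rewrite (parN _ E).
  by rewrite -parP E.
have kidP u v : (par u == Some v) =
    (isSome (rnk (sigma v)) && (cpar (sigma u) == Some (id v, rank (sigma v)))).
  rewrite parP; apply/idP/andP => [/eqP k|[]//]; split; last exact/eqP.
  by have [-> _ _ _] := g_kid G k.
apply/and3P; split.
- apply/forallP => v; case E: (par v) => [p|].
    have /eqP := E; rewrite parP => /eqP /(g_kid G)[_ ep Dv _]; rewrite ep Dv eqxx !andbT.
    by apply/eqP => vs; move: Dv; rewrite vs dist_xx.
  (* For [t = 0], [g_done] gives a parent to every node at positive distance from the source. *)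
  apply/eqP; apply: contrapT => vs; apply: (g_done G _ (parN _ E)); left.
  by rewrite lt0n; apply/eqP => /(dist_eq0 e_conn).
- apply/forallP => v /=; rewrite /max_child_rank.
  case E: (rnk (sigma v)) => [q|]; last first.
    have -> : children par v == set0.
      by apply/eqP/setP => u; rewrite !inE kidP E.
    by rewrite /rank E.
  have rq := rankE E.
  have kid u : (u \in children par v) = (cpar (sigma u) == Some (id v, q)).
    by rewrite inE kidP E rq.
  have nonempty u : cpar (sigma u) = Some (id v, q) -> (children par v == set0) = false.
    by move=> k; apply/negbTE/set0Pn; exists u; rewrite kid k.
  have maxE M : (forall u, cpar (sigma u) = Some (id v, q) -> rank (sigma u) <= M) ->
      (exists2 u, cpar (sigma u) = Some (id v, q) & rank (sigma u) = M) ->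
      \max_(u in children par v) rank (sigma u) = M.
    move=> ub [u ku ru]; apply/eqP; rewrite eqn_leq; apply/andP; split.
      by apply/bigmax_leqP => w; rewrite kid => /eqP; apply: ub.
    by rewrite -[X in X <= _]ru; apply: leq_bigmax_cond; rewrite kid ku.
  have [_ _ _ [[u1 [u2 [[ne k1 k2 r1 r2] lt]]]|[u [ku ru lt]]]] := g_rank G E.
    rewrite (nonempty _ k1) (maxE q.-1); first last.
    + by exists u1; rewrite // -r1.
    + by move=> u /lt; rewrite -r1.
    rewrite rq; case: ifP => [/cards1P[w wE]|_]; last by rewrite -r1.
    have: u1 \in [set w]; rewrite -?wE; first by rewrite inE kid k1 -r1 /= !eqxx.
    have: u2 \in [set w]; rewrite -?wE; first by rewrite inE kid k2 -r2 /= !eqxx.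
    by rewrite wE !inE => /eqP e2 /eqP e1; case: ne; rewrite e1 e2.
  rewrite (nonempty _ ku) (maxE q); first last.
  + by exists u.
  + by move=> w kw; have [->|/eqP wu] := eqVneq w u; rewrite ?ru // ltnW // lt.
  rewrite rq; suff -> : [set w in children par v | rank (sigma w) == q] = [set u].
    by rewrite cards1.
  apply/setP => w; rewrite inE kid inE.
  apply/andP/eqP => [[/eqP kw /eqP rw]|->]; last by rewrite ku ru !eqxx.
  by apply: contrapT => /(lt _ kw); rewrite rw ltnn.
- apply/forallP => u1; apply/forallP => u2; apply/forallP => v1; apply/forallP => v2.
  apply/implyP => /and5P[_ /eqP v12 p1 p2 /and4P[/eqP Du /eqP r12 /eqP rv1 /eqP rv2]].
  move: p1 p2; rewrite !parP; rewrite /= in r12 rv1 rv2.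
  have rvv : rank (sigma v1) = rank (sigma v2) by rewrite rv1 r12 rv2.
  rewrite rvv => /eqP k1 /eqP k2.
  have r1 : rank (sigma u1) = rank (sigma v2) by rewrite -rvv rv1.
  have r2 : rank (sigma u2) = rank (sigma v2) by rewrite rv2.
  apply/andP; split; first exact: (g_free G v12 k1 k2).
  by apply: (g_free G _ k2 k1) => //; apply/nesym.
Qed.

(** * One attempt: safety and progress *)

Definition hears_one (p : pred V) (v : V) : bool :=
  ~~ p v && (#|[set u | e v u & p u]| == 1).

Lemma hears_msg Y (p : pred V) v :
  isSome (hears e Y (fun u => msg (p u) 0) v) = hears_one p v.
Proof.
apply/idP/andP => [|[npv /cards1P[u uE]]].
  case E: hears => [y|] // _; case/hearsP: E; rewrite /msg.
  case: (p v) => // _ [u [x [evu fu _ uq]]]; split=> //; apply/cards1P; exists u.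
  apply/setP => w; rewrite !inE; apply/andP/eqP => [[evw pw]|->].
    by apply: uq; rewrite // pw.
  by split=> //; move: fu; case: (p u).
have mem w : e v w && p w = (w == u) by have := in_set1 w u; rewrite -uE inE.
have /andP[evu pu] : e v u && p u by rewrite mem eqxx.
have -> // : hears e Y (fun u => msg (p u) 0) v = Some (0 %% 2 ^ Y).
apply/hearsP; rewrite /msg (negbTE npv); split=> //; exists u, 0.
rewrite pu; split=> // w evw; case: ifP => // pw _.
by apply/eqP; rewrite -mem evw pw.
Qed.

Lemma hears_oneP (p : pred V) v u w :
  hears_one p v -> e v u -> p u -> e v w -> p w -> w = u.
Proof.
case/andP=> _ /cards1P[x xE] eu pu ew pw.
have : u \in [set x] by rewrite -xE inE eu.
have : w \in [set x] by rewrite -xE inE ew.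
by rewrite !inE => /eqP -> /eqP ->.
Qed.

Section Attempt.

Variables (t r : nat) (sigma : cfg).
Hypotheses (t0 : 0 < t) (rL : r <= L.+1) (G : gathered t r sigma).

Local Notation blue u := (is_blue t r (sigma u)).

Definition live (v : V) : bool :=
  ((D v).+1 == t) && (isSome (rnk (sigma v)) || (1 < #|[set u | e v u & blue u]|)).

Definition live_degree (u : V) : nat := #|[set v | e v u & live v]|.

Definition keeps tau : Prop := forall v,
  [/\ cid (tau v) = cid (sigma v), lvl (tau v) = lvl (sigma v),
      dpar (tau v) = dpar (sigma v), rnk (tau v) = rnk (sigma v) &
      cpar (tau v) = cpar (sigma v)].

Lemma keeps_blue tau v : keeps tau -> is_blue t r (tau v) = blue v.
Proof. by move=> /(_ v)[_ lE _ rE pE]; rewrite /is_blue /rank lE rE pE. Qed.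

Definition awake (j : nat) (c : V -> nat) (v : V) : bool :=
  [&& lvl (sigma v) == Some t.-1,
      isSome (rnk (sigma v)) || ~~ hears_one (fun u => blue u) v &
      c v < 2 ^ (m - j)].

Definition candidate (a : pred V) (u : V) : bool := blue u && hears_one a u.

(** Meaning of the flags from the count onwards, [a] being the set of awake red nodes. For
    [heard_reply] only soundness is recorded; that a reply gets through is a matter of
    probability. *)
Definition counted (a : pred V) tau : Prop := keeps tau /\ forall v,
  [/\ active (tau v) = a v, cand (tau v) = hears_one a v,
      heard_count (tau v) = hears_one (candidate a) v &
      heard_reply (tau v) -> exists2 u, e v u & candidate a u].

Lemma counted_step (c1 c2 c3 : coins V m) j :
  counted (awake j (fun v => c2 v))
    (cstep e (count_instr t r) c3
       (cstep e (wake_instr t j) c2 (cstep e (probe_instr t r) c1 sigma))).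
Proof.
rewrite /cstep; set tau1 := step e (probe_instr t r) _ _.
have wE v : wakes t (c2 v) j (tau1 v) = awake j (fun v => c2 v) v.
  by rewrite /wakes /is_red /awake /= -(hears_msg 0).
set tau2 := step e (wake_instr t j) _ _.
have tau2E v : [/\ keeps tau2, active (tau2 v) = awake j (fun v => c2 v) v,
    cand (tau2 v) = hears_one (awake j (fun v => c2 v)) v & heard_reply (tau2 v) = false].
  split=> //; first exact: wE.
  rewrite -(hears_msg 0); congr (isSome (hears _ _ _ _)).
  by apply: funext => u; rewrite -wE.
split=> // v; have [k2 aE cE hE] := tau2E v; split=> //.
rewrite -(hears_msg 0); congr (isSome (hears _ _ _ _)); apply: funext => u.
rewrite -[LHS]/(msg (is_blue t r (tau2 u) && cand (tau2 u)) 0).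
by have [_ _ -> _] := tau2E u; rewrite (keeps_blue _ k2).
Qed.

Lemma counted_reply a j (c : coins V m) tau :
  counted a tau -> counted a (cstep e (reply_instr t r j) c tau).
Proof.
move=> [k H]; split=> // v; have [aE cE hE ev] := H v; split=> //=.
case/orP=> [/ev //|]; case E: hears => [y|] // _.
case/hearsP: E => _ [u [x [evu fu _ _]]]; exists u => //; move: fu.
rewrite /= /msg keeps_blue // /candidate; have [_ -> _ _] := H u.
by case: ifP => // /and3P[-> ->].
Qed.

Section Recruit.

Variable a : pred V.
Hypothesis a_red : forall v, a v -> (D v).+1 = t.

Lemma not_red_candidate v : a v -> ~~ candidate a v.
Proof.
move=> /a_red Dv; apply/negP => /andP[bv _]; have [Dv' _ _] := blueP G bv.
by rewrite Dv' in Dv; lia.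
Qed.

Lemma candidate_active u : candidate a u -> exists v,
  [/\ e u v, a v & forall w, e u w -> a w -> w = v].
Proof.
case/andP=> _ hu; have /andP[_ /cards1P[v vE]] := hu.
have : v \in [set u' | e u u' & a u'] by rewrite vE inE.
rewrite inE => /andP[ev av]; exists v; split=> // w ew aw.
exact: hears_oneP hu ev av ew aw.
Qed.

Variables (tau : cfg) (c : coins V m).
Hypothesis C : counted a tau.

Local Notation tau' := (cstep e (recruit_instr t r) c tau).

Lemma new_rank_le v q : new_rank r (tau v) = Some q -> q < 2 ^ (L + 3).
Proof.
move=> E; suff : q <= L.+2.
  by move=> le; apply: leq_ltn_trans (leq_trans le _) (ltn_expl _ _); lia.
move: E; rewrite /new_rank; have [_ _ _ -> _] := C.1 v.
case E: (rnk (sigma v)) => [q'|].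
  by move=> -[<-]; rewrite -(rankE E) leqW // (rank_le _ G).
by case: ifP => // _ [<-].
Qed.

(** [v] is the only awake neighbor of the candidate [u], and only awake nodes transmit, so [u] hears
    either the message of [v] or silence. *)
Lemma recruit_cpar u v : candidate a u -> e u v -> a v ->
  cpar (tau' u) = omap (fun q => (id v, q)) (new_rank r (tau v)).
Proof.
move=> cu ev av; have [k H] := C; rewrite /cstep /step /=.
rewrite keeps_blue //; have [aE cE _ _] := H u; rewrite cE -/(candidate a u) cu.
have /andP[bu hu] := cu.
have uq w : e u w -> active (tau w) -> w = v.
  by have [-> _ _ _] := H w; apply: hears_oneP hu ev av.
have nau : active (tau u) = false by rewrite aE; case/andP: hu => /negbTE.
case E: (new_rank r (tau v)) => [q|] /=.
  pose y := q * 2 ^ W + id v.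
  have -> : hears e X (fun u0 => msg (active (tau u0) && isSome (new_rank r (tau u0)))
      (odflt 0 (new_rank r (tau u0)) * 2 ^ W + cid (tau u0))) u = Some (y %% 2 ^ X).
    apply/hearsP; rewrite nau; split=> //; exists v, y; split=> //.
      have [-> _ _ _] := H v; have [-> _ _ _ _] := k v.
      by rewrite av E /= (g_cid G).
    by move=> w ew; rewrite /msg; case: ifP => // /andP[aw _] _; apply: uq.
  have y_lt : y < 2 ^ X.
    apply: (@leq_trans (2 ^ W * q.+1)); last first.
      by rewrite expnD leq_mul2l (new_rank_le E) orbT.
    by rewrite /y mulnS mulnC addnC -addSn leq_add2r id_lt.
  rewrite (modn_small y_lt) /y modnMDl divnMDl ?expn_gt0 //.
  by rewrite modn_small ?id_lt // divn_small ?id_lt // addn0.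
rewrite hears_None // => w ew; rewrite /msg; case: ifP => // /andP[aw].
by rewrite (uq w ew aw) E.
Qed.

Lemma recruit_joined : joined t r sigma tau'.
Proof.
have [k H] := C; split.
- by move=> v; have [? ? ? _ _] := k v.
- move=> v; have [_ _ _ rE _] := k v.
  have -> : rnk (tau' v) = new_rank r (tau v) by [].
  rewrite {1 2}/new_rank rE.
  case E: (rnk (sigma v)) => [q|]; first by left.
  have [aE _ hE ev] := H v; case: ifP => [|_]; last by left.
  rewrite aE hE => /and3P[av hv nh]; have [u1 ev1 c1] := ev hv; right.
  have newE : new_rank r (tau v) = Some r.+1.
    by rewrite /new_rank rE E aE av hv hE nh.
  split=> //; first exact: a_red.
  (* If [u1] were the only candidate of [v], the joint transmission of the candidates would have set
     [heard_count]. *)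
  have [u2 [ev2 c2 ne]] : exists u2, [/\ e v u2, candidate a u2 & u1 <> u2].
    apply: contrapT => none; case/negP: nh; rewrite /hears_one not_red_candidate //=.
    apply/cards1P; exists u1; apply/setP => u; rewrite !inE.
    apply/andP/eqP => [[eu cu]|->//]; apply: contrapT => ne.
    by apply: none; exists u; split=> // /esym.
  exists u1, u2; split=> //; [by case/andP: c1|by case/andP: c2| |].
    by rewrite (@recruit_cpar u1 v) // 1?e_sym // newE.
  by rewrite (@recruit_cpar u2 v) // 1?e_sym // newE.
- move=> u; have [_ cE _ _] := H u; have [_ _ _ _ pE] := k u.
  case cu: (candidate a u); last first.
    left; rewrite /cstep /step /= keeps_blue // cE.
    by rewrite -[X in if X then _ else _]/(candidate a u) cu.
  have [v [ev av _]] := candidate_active cu.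
  have bu : blue u by case/andP: cu.
  have [_ _ pN] := blueP G bu.
  have := recruit_cpar cu ev av; case E: (new_rank r (tau v)) => [q|] /= pq.
    right; split=> //; exists v; rewrite e_sym; split=> //; first exact: a_red.
      by rewrite /cstep /step /= E.
    by rewrite pq /cstep /step /rank /= E.
  by left; rewrite pq pN.
Qed.

End Recruit.

Lemma awake_red j c v : awake j c v -> (D v).+1 = t.
Proof. by case/and3P=> /eqP; rewrite (g_lvl G) => -[->] _ _; rewrite prednK. Qed.

Lemma attempt_joined j : surely e m (attempt t r j) (joined t r sigma) sigma.
Proof.
move=> c1 c2 c3; set a := awake j (fun v => c2 v).
apply: (@surely_seq _ _ _ _ _ _ (counted a)).
  by apply: surely_map (counted_step _ _ _ _) => j' c tau; apply: counted_reply.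
move=> tau C c; apply: (recruit_joined (a := a)) C => v; exact: awake_red.
Qed.

(** A neighbor of a blue node has at least one blue neighbor, so hearing nothing from the probe
    means having at least two. *)
Lemma awake_live j c u v : blue u -> e v u ->
  awake j c v = live v && (c v < 2 ^ (m - j)).
Proof.
move=> bu ev; rewrite /awake /live (g_lvl G).
have -> : (Some (D v) == Some t.-1) = ((D v).+1 == t).
  by rewrite (inj_eq Some_inj) -[in RHS](prednK t0) eqSS.
rewrite -andbA; case: eqP => //= Dv; congr (_ && _); congr (_ || _).
have nb : ~~ blue v.
  by apply/negP => /(blueP G)[Dv' _ _]; rewrite Dv' in Dv; lia.
rewrite /hears_one nb /=; set A := [set _ | _ & _].
have : 0 < #|A| by apply/card_gt0P; exists u; rewrite inE ev.
by case: #|A| => [|[|]].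
Qed.

Local Open Scope ring_scope.

(** A ranked [v] recruits in any case. Otherwise one reply must get through, which a Decay sweep
    over the candidates of [v] grants with probability 1/8; the second candidate keeps [heard_count]
    unset. *)
Lemma recruit_progress (a : pred V) tau u v :
  (forall w, a w -> (D w).+1 = t) -> counted a tau ->
  a v -> e v u -> candidate a u ->
  (rnk (sigma v) <> None \/ exists2 u2, u2 <> u & e v u2 && candidate a u2) ->
  8%:R^-1 <= pr e m ([seq reply_instr t r j | j <- iota 1 (L + 2)] ++
                     [:: recruit_instr t r])
               (fun tau' => ~~ is_blue t r (tau' u)) tau.
Proof.
move=> ar C av ev cu many; rewrite /pr wp_cat.
pose B (tau : cfg) := rnk (sigma v) <> None \/ heard_reply (tau v).
have Cst j (c : coins V m) tau1 : counted a tau1 ->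
    counted a (cstep e (reply_instr t r j) c tau1) by apply: counted_reply.
apply: (@le_trans _ _
  (pr e m [seq reply_instr t r j | j <- iota 1 (L + 2)] B tau)); last first.
  apply: (@wp_le_surely _ _ _ _ _ (counted a)); first exact: surely_map C.
  pose Q (tau' : cfg) : Prop := ~~ is_blue t r (tau' u).
  move=> tau1 C1; case: asboolP => [Bt|_]; last first.
    exact: (pr_ge0 e m [:: recruit_instr t r] Q tau1).
  rewrite -[wp _ _ _ _ _]/(pr e m [:: recruit_instr t r] Q tau1) pr_surely // => c.
  have [k H] := C1; have [aE _ hE _] := H v; have [_ _ _ rE _] := k v.
  apply/negP => /and3P[_ _]; rewrite (@recruit_cpar a tau1 c C1 u v) // 1?e_sym //.
  suff : new_rank r (tau1 v) <> None by case: new_rank.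
  rewrite /new_rank rE; case E: (rnk (sigma v)) => [q|] //.
  case: Bt => [|->]; first by rewrite E.
  rewrite aE av hE; suff -> : ~~ hears_one (candidate a) v by [].
  case: many => [|[u2 ne /andP[e2 c2]]]; first by rewrite E.
  by apply/negP => h1; apply: ne; apply: (hears_oneP h1).
pose A := [set w | e v w & candidate a w].
have A0 : (0 < #|A|)%N by apply/card_gt0P; exists u; rewrite inE ev.
have [j jL Hj] := decay A0.
apply: (@pr_map _ _ _ _ _ _ _ j (counted a)) C => //.
  by move=> j' c tau1 _ [|hv]; [left|right; rewrite /= hv].
move=> tau1 C1; apply: Hj => // c w; rewrite inE => /andP[ew cw] iso.
rewrite asboolT //; right; apply/orP; right.
have [k H] := C1.
have txE x : tx (reply_instr t r j) (tau1 x) (c x) =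
    msg (candidate a x && (c x < 2 ^ (m - j))%N) 0.
  by rewrite /= keeps_blue //; have [_ -> _ _] := H x; rewrite andbA.
suff -> : hears e 0 (fun x => tx (reply_instr t r j) (tau1 x) (c x)) v =
          Some (0 %% 2 ^ 0)%N by [].
apply/hearsP; rewrite txE (negbTE (not_red_candidate ar av)); split=> //.
exists w, 0%N; rewrite txE cw; split=> //; first by case/andP: iso => ->.
move=> x ex; rewrite txE /msg; case: ifP => // /andP[cx lt] _.
by apply: (isolated_in iso) => //; rewrite inE ex.
Qed.

(** [1/128 = 1/16 * 1/8]: with probability 1/16 some live neighbor [v] of [u] wakes up alone among
    the live neighbors of [u] and of another blue neighbor of [v], which makes both of them
    candidates of [v]; the replies then succeed with probability 1/8. *)
Lemma attempt_progress k u :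
  (k <= L)%N -> (forall u', blue u' -> (live_degree u' < 2 ^ k.+1)%N) ->
  blue u -> (2 ^ k <= live_degree u)%N ->
  128%:R^-1 <= pr e m (attempt t r k.+3) (fun tau => ~~ is_blue t r (tau u)) sigma.
Proof.
move=> kL degs bu degu; set j := k.+3.
rewrite -[leLHS](expectation_const V m) /pr /=; apply: le_expectation => c1.
pose S := [set v | e v u & live v].
(* The default [u] is taken when [v] has no other blue neighbor; being live, [v] then has a rank and
   needs no second candidate. *)
pose mate v := odflt u [pick u2 | [&& e v u2, blue u2 & u2 != u]].
pose Wv v := [set w | e w u & live w] :|: [set w | e w (mate v) & live w].
have mateb v : blue (mate v).
  by rewrite /mate; case: pickP => //= x /and3P[].
set f := fun c => expectation _.
have := @isolation V m j (2 ^ k.+2) S (fun v => Wv v :\ v) 8%:R^-1 f.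
have j_le : (j <= m)%N by rewrite /j; lia.
have q0 : (0 : rat) <= 8%:R^-1 by lra.
have f0 c : 0 <= f c.
  rewrite -[leLHS](expectation_const V m); apply: le_expectation => c3.
  exact: pr_ge0.
move=> /(_ j_le q0 f0) H; apply: le_trans (H _ _ _ _).
(* [#|S| * 2 ^- j] is at least [2 ^ k / 2 ^ (k + 3) = 1/8]. [Wv v] joins two sets of fewer than
   [2 ^ k.+1] nodes, so the other factor is at least [1 - 2 ^ k.+2 / 2 ^ k.+3 = 1/2]. *)
- rewrite natrX; set x := 2%:R ^- j.
  have jE : x = 8%:R^-1 * 2%:R ^- k.
    by rewrite /x -invfM; congr (_^-1); rewrite /j !exprS; ring.
  have y0 : 2%:R ^+ k != 0 :> rat by rewrite expf_neq0.
  have -> : 2%:R ^+ k.+2 * x = 2%:R^-1.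
    by rewrite jE !exprS; field.
  have : 8%:R^-1 <= #|S|%:R * x.
    rewrite jE mulrCA -[leLHS]mulr1 ler_wpM2l // ler_pdivlMr ?exprn_gt0 // mul1r.
    by rewrite -natrX ler_nat.
  move: (#|S|%:R * x) => z; lra.
- by move=> v _; rewrite !inE eqxx.
- by move=> v _; apply: setSD; apply: subsetUl.
- move=> v _; apply: leq_trans (subset_leq_card (subsetDl _ _)) _.
  apply: leq_trans (leq_card_setU _ _) _.
  have := degs _ bu; have := degs _ (mateb v); rewrite /live_degree (expnS 2 k.+1).
  by move: (2 ^ k.+1)%N => ?; lia.
move=> c v; rewrite inE => /andP[ev lv] /andP[cv /forall_inP iso].
rewrite -[leLHS](expectation_const V m); apply: le_expectation => c3.
set a := awake j (fun v => c v).
have ar w : a w -> (D w).+1 = t by apply: awake_red.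
have av : a v by rewrite /a (awake_live _ _ bu ev) lv cv.
have cnd u1 : blue u1 -> e v u1 -> [set w | e w u1 & live w] \subset Wv v ->
    candidate a u1.
  move=> b1 ev1 /subsetP sub; rewrite /candidate b1 /=; apply/andP; split.
    by apply/negP => /ar; have [-> _ _] := blueP G b1; lia.
  apply/cards1P; exists v; apply/setP => w; rewrite !inE.
  apply/andP/eqP => [[ew aw]|->]; last by rewrite e_sym.
  rewrite e_sym in ew; move: aw; rewrite /a (awake_live _ _ b1 ew) => /andP[lw cw].
  apply/eqP; apply: contraLR cw => wv; apply: iso; rewrite in_setD1 wv /=.
  by apply: sub; rewrite inE ew.
apply: (@recruit_progress a _ u v ar (counted_step _ _ _ _) av ev).
  by apply: cnd => //; apply: subsetUl.
case/andP: lv => _ /orP[rv|/card_gt1P[x [y [xA yA xy]]]].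
  by left; case: (rnk _) rv.
right; have [z] : exists z, [&& e v z, blue z & z != u].
  move: xA yA; rewrite !inE => /andP[ex bx] /andP[ey bY].
  have [xu|xu] := eqVneq x u; last by exists x; rewrite ex bx.
  by exists y; rewrite ey bY -xu eq_sym.
have := erefl (mate v); rewrite {1}/mate; case: pickP => [z' /and3P[ez bz zu] mE _|->//].
exists z'; first exact/eqP.
by rewrite ez cnd // -[z']/(odflt u (Some z')) mE; apply: subsetUr.
Qed.

End Attempt.

(** * Scales, phases and the whole program *)

Lemma joined_live_degree t r sigma tau u : gathered t r sigma -> joined t r sigma tau ->
  live_degree t r tau u <= live_degree t r sigma u.
Proof.
move=> G J; apply: subset_leq_card; apply/subsetP => v; rewrite !inE => /andP[-> ] /=.
case/andP=> Dv lv; rewrite /live Dv /=.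
have sub w : is_blue t r (tau w) -> is_blue t r (sigma w) by apply: joined_blue.
(* Blue nodes only disappear, and a node that has just been ranked had two blue neighbors, so it was
   live before. *)
case: (j_rnk J v) => [rE|[rN _ _ [u1 [u2 [/eqP ne b1 b2 p1 p2]]]]].
  case/orP: lv => [|gt1]; first by rewrite rE => ->.
  apply/orP; right; apply: leq_trans gt1 _; apply: subset_leq_card.
  by apply/subsetP => w; rewrite !inE => /andP[-> /sub ->].
apply/orP; right; apply/card_gt1P; exists u1, u2; rewrite !inE b1 b2 ne !andbT.
have ev w : is_blue t r (sigma w) -> cpar (tau w) = Some (id v, r.+1) -> e v w.
  by move=> bw /(joined_kid J)[|[]] //; have [_ _ ->] := blueP G bw.
by split=> //; apply: ev.
Qed.

Definition sparse (t r k : nat) sigma : Prop := gathered t r sigma /\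
  forall u, is_blue t r (sigma u) -> live_degree t r sigma u < 2 ^ k.

Lemma joined_sparse t r k sigma tau :
  sparse t r k sigma -> joined t r sigma tau -> sparse t r k tau.
Proof.
move=> [G deg] J; split; first exact: joined_gathered J.
by move=> u /(joined_blue G J)/deg; apply: leq_ltn_trans; apply: joined_live_degree.
Qed.

(** Live degrees never increase, so a blue node that falls below [2 ^ k] stays there, and
    [attempt_progress] applies to the others in every retry. *)
Lemma hoare_scale t r k : 0 < t -> r <= L.+1 -> k <= L ->
  hoare e m (sparse t r k.+1) (retry T (attempt t r k.+3)) (sparse t r k)
    (#|V|%:R * failure)%R.
Proof.
move=> t0 rL kL.
pose B u (sigma : cfg) := is_blue t r (sigma u) -> live_degree t r sigma u < 2 ^ k.
have Js sigma : gathered t r sigma ->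
    surely e m (attempt t r k.+3) (joined t r sigma) sigma.
  by move=> G; apply: attempt_joined.
have As sigma : sparse t r k.+1 sigma ->
    surely e m (attempt t r k.+3) (sparse t r k.+1) sigma.
  by move=> Sp; apply: surely_mono (Js _ Sp.1) => tau; apply: joined_sparse.
apply: (@hoare_weaken _ _ _ _ (sparse t r k.+1) _
  (fun tau => (forall u, B u tau) /\ sparse t r k.+1 tau)) => //.
  by move=> tau [BH [G _]].
apply: hoare_and_surely; first by move=> sigma; apply: surely_retry.
apply: hoare_forall => u sigma Hs.
apply: (@pr_retry _ _ _ _ _ _ (sparse t r k.+1) (B u)) Hs; [lra|exact: As| |].
  move=> tau [G _] Bt; apply: surely_mono (Js _ G) => tau' J bu.
  apply: leq_ltn_trans (joined_live_degree _ G J) _.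
  exact/Bt/(joined_blue G J).
move=> tau [G deg] nB.
have [bu ge] : is_blue t r (tau u) /\ 2 ^ k <= live_degree t r tau u.
  split; first by apply: contra_notT nB => nb bu; rewrite bu in nb.
  by rewrite leqNgt; apply/negP => lt; apply: nB.
apply: le_trans (attempt_progress t0 rL G kL deg bu ge) _.
apply: (pr_le_surely (Js _ G)) => tau' _ nb bu'.
by rewrite bu' in nb.
Qed.

Lemma settle_gathered t r (c : coins V m) sigma : 0 < t ->
  sparse t r.+1 0 sigma -> gathered t r (cstep e (settle_instr t r.+1) c sigma).
Proof.
move=> t0 [G deg].
have lone u v : is_blue t r.+1 (sigma u) -> e v u -> (D v).+1 = t ->
    rnk (sigma v) = None /\
    forall u', is_blue t r.+1 (sigma u') -> e v u' -> u' = u.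
  move=> bu ev Dv; have := deg u bu; rewrite expn0 ltnS leqn0 cards_eq0.
  move=> /eqP/setP/(_ v); rewrite !inE ev /live Dv eqxx /= => /negbT.
  rewrite negb_or -leqNgt; case: (rnk (sigma v)) => //= le1; split=> // u' bu' ev'.
  by apply: (card_le1_eqP le1); rewrite inE ?ev ?ev'.
have not_blue v : (D v).+1 = t -> is_blue t r.+1 (sigma v) = false.
  by move=> Dv; apply/negP => /(blueP G)[Dv' _ _]; rewrite Dv' in Dv; lia.
apply: (settled_gathered G t0 lone) => // [v|u v bu ev Dv du].
  case E: (rnk (sigma v)) => [q|]; first by left; rewrite /cstep /step /= E.
  rewrite /cstep /step /= E; case: ifP => [/andP[_ /eqP hv]|_]; [right|by left].
  split=> //; case/hearsP: hv => _ [u [x [evu fu xE _]]]; exists u.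
  move: fu; rewrite /= /msg; case: ifP => // bu [dx]; split=> //.
  have [w [dw _ _]] := blue_dpar G t0 bu.
  by rewrite -(g_cid G) xE -dx dw id_mod.
have [rN uq] := lone u v bu ev Dv.
rewrite /cstep /step /= rN.
suff -> : hears e X (fun w => msg (is_blue t r.+1 (sigma w)) (dpar (sigma w))) v =
    Some (dpar (sigma u) %% 2 ^ X).
  by rewrite du id_mod (g_cid G) eqxx andbT /is_red (g_lvl G) -Dv /= eqxx.
apply/hearsP; rewrite (not_blue _ Dv); split=> //; exists u, (dpar (sigma u)).
rewrite bu; split=> // w ew; rewrite /msg; case: ifP => // bw _.
exact: uq.
Qed.

Lemma hoare_phase t r : 0 < t -> r < L.+1 ->
  hoare e m (gathered t r.+1) (phase t r.+1) (gathered t r)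
    (L.+1%:R * (#|V|%:R * failure))%R.
Proof.
move=> t0 rL; have f0 := failure_ge0.
rewrite -[X in hoare _ _ _ _ _ X]addr0; apply: (@hoare_cat _ _ _ _ _ (sparse t r.+1 0)) => //.
  apply: (@hoare_weaken _ _ _ _ (sparse t r.+1 L.+1) _ (sparse t r.+1 0)) => //.
    move=> sigma G; split=> // u _; apply: leq_ltn_trans card_lt; exact: max_card.
  apply: (@hoare_downfrom _ _ _ _ _ _ (sparse t r.+1)); first by rewrite mulr_ge0.
  by move=> k kL; apply: hoare_scale.
by apply: hoare_surely => sigma Sp c; apply: settle_gathered.
Qed.

(** Union bound: a term [#|V| * failure] for each layer, and one for each level, rank and scale. *)
Definition program_failure : rat :=
  (Dhat%:R * (#|V|%:R * failure) +
   Dhat%:R * (L.+1%:R * (L.+1%:R * (#|V|%:R * failure))))%R.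

Lemma hoare_program :
  hoare e m (layered 0) program (gathered 0 L.+1) program_failure.
Proof.
have f0 := failure_ge0.
have nf0 : (0 <= #|V|%:R * failure)%R by rewrite mulr_ge0.
apply: (@hoare_cat _ _ _ _ _ (gathered Dhat L.+1)); first by rewrite !mulr_ge0.
  apply: (@hoare_weaken _ _ _ _ (layered 0) _ (layered Dhat)) => //.
    exact: gathered_layered.
  by apply: hoare_upto => // k _; apply: hoare_layering.
apply: (@hoare_downfrom _ _ _ _ _ _ (fun t => gathered t L.+1)).
  by rewrite !mulr_ge0.
move=> t _.
apply: (@hoare_weaken _ _ _ _ (gathered t.+1 L.+1) _ (gathered t.+1 0)) => //.
  exact: gathered_next_level.
apply: (@hoare_downfrom _ _ _ _ _ _ (gathered t.+1)); first by rewrite !mulr_ge0.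
by move=> r rL; apply: hoare_phase.
Qed.

Lemma layered_init : layered 0 (fun v => init_node (id v) (v == s)).
Proof.
move=> v; have [->|vs] := eqVneq v s.
  by split=> //=; left; rewrite dist_xx.
split=> //; right; split=> //; rewrite lt0n; apply: contraNneq vs.
by move/(dist_eq0 e_conn) ->.
Qed.

Lemma success_program B :
  (1 - program_failure <=
   success_probability e s id (compile m program init_node output_node B))%R.
Proof.
rewrite success_probability_compile lerBlDr -lerBlDl -pr_not.
apply: le_trans (hoare_program layered_init); apply: wp_le => tau.
rewrite ler_nat; have [/gathered_gst g|ng] := pselect (gathered 0 L.+1 tau).
  by rewrite asboolF.
by rewrite [`[< ~ gathered _ _ _ >]]asboolT ?leq_b1.
Qed.

End Analysis.

End Algorithm.

(** * Numerical bounds on failure and duration *)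

Lemma expr_1B_le (q : rat) k : (0 <= q <= 1 -> (1 - q) ^+ k * (1 + k%:R * q) <= 1)%R.
Proof.
move=> /andP[q0 q1]; elim: k => [|k IH]; first by rewrite expr0 mul0r addr0 mulr1.
apply: le_trans IH; rewrite exprS mulrAC [leLHS]mulrC.
apply: ler_wpM2l; first by rewrite exprn_ge0 // subr_ge0.
rewrite -natr1; have : (0 <= k%:R * q * q :> rat)%R by rewrite !mulr_ge0.
have : (0 <= q * q :> rat)%R by rewrite mulr_ge0.
by move: (k%:R : rat)%R => x; nra.
Qed.

Lemma expr_1Binv_le k : (0 < k)%N -> ((1 - k%:R^-1) ^+ k <= 2%:R^-1 :> rat)%R.
Proof.
move=> k0; have kR0 : (0 < k%:R :> rat)%R by rewrite ltr0n.
have /(expr_1B_le k) : (0 <= (k%:R^-1 : rat) <= 1)%R.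
  by rewrite invr_ge0 ltW //= invf_le1 // ler1n.
by rewrite divff ?gt_eqF // => le1; rewrite -[leRHS]mul1r ler_pdivlMr.
Qed.

Lemma expr_1Binv_mul_le k h n : 0 < k ->
  ((1 - k%:R^-1) ^+ (k * (h * n)) <= (2 ^ n)%:R ^- h :> rat)%R.
Proof.
move=> k0; have half := expr_1Binv_le k0.
rewrite exprM; apply: le_trans (_ : (2%:R^-1) ^+ (h * n) <= _)%R.
  apply: lerXn2r half; rewrite nnegrE ?invr_ge0 // exprn_ge0 // subr_ge0.
  by rewrite invf_le1 ?ler1n // ltr0n.
by rewrite exprVn natrX -exprM mulnC.
Qed.

Lemma failure_le h n : (failure (128 * (h * n)) <= (2 ^ n)%:R ^- h :> rat)%R.
Proof. exact: expr_1Binv_mul_le. Qed.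

Section Duration.

Variable S : Type.
Implicit Types (P : seq (instr S)) (F : nat -> seq (instr S)).

Lemma duration_cat P1 P2 : duration (P1 ++ P2) = duration P1 + duration P2.
Proof. by rewrite /duration big_cat. Qed.

Lemma duration_retry T P : duration (retry T P) = T * duration P.
Proof.
elim: T => [|T IH] /=; first by rewrite /duration big_nil.
by rewrite duration_cat IH mulSn.
Qed.

Lemma duration_upto n F M :
  (forall k, duration (F k) <= M) -> duration (upto n F) <= n * M.
Proof.
move=> H; elim: n => [|n IH] /=; first by rewrite /duration big_nil.
by rewrite duration_cat mulSnr leq_add.
Qed.

Lemma duration_downfrom n F M :
  (forall k, duration (F k) <= M) -> duration (downfrom n F) <= n * M.
Proof.
move=> H; elim: n => [|n IH] /=; first by rewrite /duration big_nil.
by rewrite duration_cat mulSn leq_add.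
Qed.

Lemma duration_map (I : Type) (F : I -> instr S) (s : seq I) X :
  (forall x, width (F x) = X) -> duration [seq F x | x <- s] = size s * X.+1.
Proof.
move=> H; rewrite /duration big_map; under eq_bigr do rewrite H.
by rewrite big_const_seq iter_addn_0 count_predT mulnC.
Qed.

End Duration.

(** A level has [L.+1] ranks, [L.+1] scales each, and [T] attempts per scale; an attempt takes
    [O(L)] rounds since only its last instruction is wide. Layering costs a cubic term per level,
    rounded up to the fourth power. *)
Lemma duration_program L a h Dhat :
  duration (program L (a * L.+1) (128 * (h * L.+1)) Dhat) <=
  Dhat * ((256 * h * (a + 4) + 128 * h * (a + 9) + a + 4) * L.+1 ^ 4).
Proof.
set W := a * L.+1; set T := 128 * (h * L.+1).
have X_le : (W + (L + 3)).+1 <= (a + 4) * L.+1 by rewrite /W mulnDl; lia.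
have lay d : duration (layering L W T d) <= 256 * h * (a + 4) * L.+1 ^ 4.
  rewrite duration_retry (@duration_map _ _ _ _ (W + (L + 3))) // size_iota.
  apply: (@leq_trans (T * (2 * L.+1 * ((a + 4) * L.+1)))).
    by rewrite leq_mul2l leq_mul ?orbT //; lia.
  rewrite [leqLHS](_ : _ = 256 * h * (a + 4) * L.+1 ^ 3); last by rewrite /T; ring.
  by rewrite leq_mul2l leq_pexp2l ?orbT.
have att t r j : duration (attempt L W t r j) <= (a + 9) * L.+1.
  rewrite !duration_cat (@duration_map _ _ _ _ 0) // size_iota.
  rewrite /duration !big_cons !big_nil /= mulnDl; move: X_le; rewrite mulnDl; lia.
have pha t r : duration (phase L W T t r) <=
    (128 * h * (a + 9) + a + 4) * L.+1 ^ 3.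
  rewrite duration_cat.
  apply: (@leq_trans (L.+1 * (T * ((a + 9) * L.+1)) + (a + 4) * L.+1)).
    apply: leq_add; last by rewrite /duration big_cons big_nil addn0.
    by apply: duration_downfrom => k; rewrite duration_retry leq_mul2l att orbT.
  rewrite [leqRHS](_ : _ = 128 * h * (a + 9) * L.+1 ^ 3 + (a + 4) * L.+1 ^ 3);
    last by ring.
  apply: leq_add; last first.
    by rewrite leq_mul2l -{1}(expn1 L.+1) leq_pexp2l ?orbT.
  by apply: eq_leq; rewrite /T; ring.
rewrite duration_cat [leqRHS](_ : _ = Dhat * (256 * h * (a + 4) * L.+1 ^ 4) +
  Dhat * ((128 * h * (a + 9) + a + 4) * L.+1 ^ 4)); last by ring.
apply: leq_add; first exact: duration_upto.
apply: duration_downfrom => t; apply: leq_trans (duration_downfrom _ (pha t)) _.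
by apply: eq_leq; rewrite expnS; ring.
Qed.

Lemma program_failure_le (V : finType) K c L Dhat :
  #|V| < 2 ^ L.+1 -> 0 < #|V| -> Dhat <= K * #|V| ->
  (program_failure L (128 * ((c + K + 4) * L.+1)) Dhat V <= (#|V|%:R ^+ c)^-1)%R.
Proof.
move=> Vlt V0 le; set Z := 2 ^ L.+1.
have L_lt : L.+1 < Z by apply: ltn_expl.
have Z0 : 0 < Z by rewrite expn_gt0.
(* The factors are [Dhat <= K * #|V| <= Z ^ K * Z], using [K <= 2 ^ K], then [#|V| <= Z] and
   [1 + L.+1 * L.+1 <= Z * Z]. *)
have count : Dhat * #|V| * (1 + L.+1 * L.+1) <= Z ^ (K + 4).
  rewrite expnD; apply: (@leq_trans (Z ^ K * Z * Z * (Z * Z))); last first.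
    by apply: eq_leq; ring.
  apply: leq_mul; last by nia.
  apply: leq_mul; last exact: ltnW.
  apply: leq_trans le _; apply: leq_mul; last exact: ltnW.
  apply: leq_trans (ltnW (ltn_expl K (isT : 1 < 2))) _.
  by case: (K) => // K'; rewrite leq_exp2r //; apply: leq_trans L_lt.
have := failure_le (c + K + 4) L.+1; set f := failure _ => f_le.
have -> : (program_failure L (128 * ((c + K + 4) * L.+1)) Dhat V =
    (Dhat * #|V| * (1 + L.+1 * L.+1))%:R * f :> rat)%R.
  by rewrite /program_failure -/f !natrM natrD natrM; ring.
apply: le_trans (_ : ((Z ^ (K + 4))%:R * Z%:R ^- (c + K + 4) <= _ :> rat)%R).
  apply: ler_pM => //; [exact: failure_ge0|by rewrite ler_nat].
have Zn0 : (Z%:R != 0 :> rat)%R by rewrite pnatr_eq0 -lt0n.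
rewrite natrX -addnA [(_ ^+ (c + _))%R]exprD invfM mulrCA mulfV ?mulr1 ?expf_neq0 //.
rewrite lef_pV2 ?posrE ?exprn_gt0 ?ltr0n //.
by apply: lerXn2r; rewrite ?nnegrE // ler_nat ltnW.
Qed.

(** * Choice of parameters and conclusion *)

Theorem theorem4 (a b K c : nat) (hc : 1 <= c) :
  exists (A : algorithm) (C : nat),
  forall (V : finType) (e : rel V) (s : V) (id : V -> nat) (N Dhat B : nat),
    simple_graph e ->
    connected_graph e ->
    injective id ->
    (forall v : V, id v < #|V| ^ a) ->
    #|V| <= N <= #|V| ^ a ->
    diameter e <= Dhat <= K * diameter e ->
    trunc_log 2 #|V| <= b * B ->
    rounds (A N Dhat B) <= C * (diameter e * trunc_log 2 #|V| ^ 4) /\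
    (1 - (#|V|%:R ^+ c)^-1 <= success_probability e s id (A N Dhat B))%R.
Proof.
(* In the exponent, [K + 4] pays for the union bound and [c] remains. Below, [a * L.+1] bits hold
   the ids, and [128 * (h * L.+1)] retries bring [failure] down to [2 ^- (h * L.+1)]. *)
pose h := c + K + 4.
pose c0 := 256 * h * (a + 4) + 128 * h * (a + 9) + a + 4.
exists (fun N Dhat B => let L := trunc_log 2 N in
  compile (L + 3) (program L (a * L.+1) (128 * (h * L.+1)) Dhat)
    init_node output_node B), (K * c0 * (2 * a) ^ 4).
move=> V e s id N Dhat B [e_sym _] e_conn id_inj id_lt /andP[nN Na] /andP[DD DK] _.
set L := trunc_log 2 N.
have N_lt : N < 2 ^ L.+1 by apply: trunc_log_ltn.
have V_lt : #|V| < 2 ^ L.+1 by apply: leq_ltn_trans N_lt.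
have V0 : 0 < #|V| by apply/card_gt0P; exists s.
split; last first.
  apply: (@le_trans _ _ (1 - program_failure L (128 * (h * L.+1)) Dhat V)%R).
    rewrite lerD2l lerN2; apply: program_failure_le => //.
    by apply: leq_trans DK _; rewrite leq_mul2l diameter_le_card orbT.
  apply: success_program => // v.
    apply: leq_trans (id_lt v) _; rewrite mulnC expnM.
    by case: (a) => // a'; rewrite leq_exp2r // ltnW.
  exact: leq_trans (dist_le_diameter _ _ _) DD.
(* For a single node the diameter is 0, which forces [Dhat = 0] and a program of no rounds. *)
have [V1|V1] := leqP #|V| 1.
  have D0 : diameter e = 0.
    apply/eqP; rewrite -leqn0; apply/bigmax_leqP => x _; apply/bigmax_leqP => y _.
    by rewrite (fintype_le1P V1 y x) dist_xx.
  move: DK; rewrite D0 muln0 leqn0 => /eqP ->.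
  by apply: leq_trans (duration_program _ _ _ _) _.
set l := trunc_log 2 #|V|.
have l0 : 0 < l by rewrite -[0]/(trunc_log 2 1) /l trunc_log_gt0.
(* From [2 ^ L <= N <= #|V| ^ a < 2 ^ (a * l.+1)] follows [L.+1 <= a * l.+1], and [l.+1 <= 2 * l] as
   [l > 0]. *)
have L_le : L.+1 <= 2 * a * l.
  have a0 : 0 < a.
    by case: (a) Na => // N1; have := leq_trans V1 (leq_trans nN N1); rewrite ltnn.
  have : 2 ^ L < 2 ^ (a * l.+1).
    apply: leq_ltn_trans (trunc_logP _ _) _ => //; first exact: leq_trans nN.
    apply: leq_ltn_trans Na _; rewrite mulnC expnM.
    by rewrite ltn_exp2r // trunc_log_ltn.
  rewrite ltn_exp2l // => /leq_trans; apply.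
  by nia.
apply: leq_trans (duration_program _ _ _ _) _; rewrite -/c0.
apply: (@leq_trans (K * diameter e * (c0 * (2 * a * l) ^ 4))).
  apply: leq_mul => //; rewrite leq_mul2l; apply/orP; right.
  by rewrite leq_exp2r.
by apply: eq_leq; rewrite !expnMn; ring.
Qed.
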